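(* Let $M=(E,\mathcal{B})$ be a matroid on the ground set $E=[n]=\{1,\dots,n\}$, and let $\mathcal{I}$ be its collection of independent sets. Then the matroid independence polytope $P_{\mathcal{I}}=\operatorname{conv}\{\chi_I : I\in\mathcal{I}\}\subset\mathbb{R}^n$ has a regular unimodular triangulation.
   Context: A matroid is a pair $M=(E,\mathcal{B})$ with $E$ a finite set and $\mathcal{B}$ a nonempty collection of subsets of $E$ (the bases) such that for all $B_1,B_2\in\mathcal{B}$ and $x\in B_1\setminus B_2$ there is $y\in B_2\setminus B_1$ with $(B_1\setminus\{x\})\cup\{y\}\in\mathcal{B}$. A set $I\subseteq E$ is independent if $I\subseteq B$ for some $B\in\mathcal{B}$. For $S\subseteq[n]$, $\chi_S\in\mathbb{R}^n$ is the indicator vector: $\chi_S(i)=1$ if $i\in S$ and $0$ otherwise. A subdivision of a polytope $P$ is a finite collection $\mathcal{S}=\{P_1,\dots,P_k\}$ of polytopes such that (1) $\bigcup_i P_i=P$; (2) every face of each $P_i$ belongs to $\mathcal{S}$; (3) for all $i,j$, $P_i\cap P_j$ is a face of both $P_i$ and $P_j$. A triangulation is a subdivision all of whose members are simplices. Given a finite subset $S\subset P$ containing the vertices of $P$ and a function $f:S\to\mathbb{R}$, the subdivision of $P$ induced by $f$ is the one formed by projecting to $P$ (forgetting the last coordinate) the lower faces of $\operatorname{conv}\{(x,f(x)):x\in S\}\subset\mathbb{R}^{n+1}$, where a lower face is a face on which some linear functional with positive last coefficient is minimized. A subdivision is regular if it is induced by some such function $f$. For a set $T\subseteq\mathbb{R}^n$,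 $\operatorname{lin}(T)$ denotes the linear subspace parallel to, and of the same dimension as, the affine span of $T$. A simplex $T$ with vertices in $\mathbb{Z}^n$ is unimodular if a maximal linearly independent set of its edge vectors (differences of two vertices) forms a lattice basis of $\operatorname{lin}(T)\cap\mathbb{Z}^n$ (equivalently, it has normalized volume 1). A triangulation is unimodular if all its simplices are unimodular. *)

(* Defs.v *)
From mathcomp Require Import all_boot all_order all_algebra.
From mathcomp Require Import boolp classical_sets functions cardinality reals.

Set Implicit Arguments.
Unset Strict Implicit.
Unset Printing Implicit Defensive.

Import Order.TTheory GRing.Theory Num.Theory.

Local Open Scope ring_scope.

Record matroid (E : finType) := Matroid {
  bases : {set {set E}};
  bases_neq0 : bases != finset.set0;
  basis_exchange : forall (B1 B2 : {set E}) (x : E),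
    B1 \in bases -> B2 \in bases -> x \in B1 :\: B2 ->
    exists2 y, y \in B2 :\: B1 & y |: (B1 :\ x) \in bases
}.

Definition independent (E : finType) (M : matroid E) (I : {set E}) : bool :=
  [exists B in bases M, I \subset B].

Definition chi (R : realType) (n : nat) (S : {set 'I_n}) : 'rV[R]_n :=
  \row_i (i \in S)%:R.
Arguments chi R {n} S.

Local Open Scope classical_set_scope.

Section ConvexGeometry.
Variables (R : realType) (n : nat).
Implicit Types (A P Q F T : set 'rV[R]_n) (c x : 'rV[R]_n).

Definition conv A : set 'rV[R]_n :=
  [set x | exists (k : nat) (p : 'I_k -> 'rV[R]_n) (w : 'I_k -> R),
     [/\ forall i, A (p i), forall i, 0 <= w i, \sum_i w i = 1
       & x = \sum_i w i *: p i]].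

Definition polytope P : Prop := exists2 A, finite_set A & P = conv A.

Definition dotp c x : R := \sum_i c 0 i * x 0 i.

(* Points of P where the inequality c.x >= b, valid on P, is tight: either the
   minimizers of c on P or, when b is smaller than the minimum, the empty set. *)
Definition face_by c (b : R) P F : Prop :=
  (forall x, P x -> b <= dotp c x) /\ F = P `&` [set x | dotp c x = b].

(* The empty set and P itself are faces of P; the empty set is accordingly a
   polytope, and a simplex without vertices. *)
Definition face P F : Prop := exists c b, face_by c b P F.

Definition vertex P : set 'rV[R]_n := [set x | face P [set x]].

Definition affinely_independent (k : nat) (v : 'I_k -> 'rV[R]_n) : Prop :=
  forall a : 'I_k -> R,
    \sum_i a i = 0 -> \sum_i a i *: v i = 0 -> forall i, a i = 0.

Definition simplex_on (k : nat) (v : 'I_k -> 'rV[R]_n) T : Prop :=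
  affinely_independent v /\ T = conv (range v).

Definition simplex T : Prop :=
  exists (k : nat) (v : 'I_k -> 'rV[R]_n), simplex_on v T.

(* Direction of the affine span of T, as the linear span of the differences of
   points of T; it is {0} when T is empty. *)
Definition lin T : set 'rV[R]_n :=
  [set x | exists (k : nat) (p q : 'I_k -> 'rV[R]_n) (a : 'I_k -> R),
     [/\ forall i, T (p i), forall i, T (q i)
       & x = \sum_i a i *: (p i - q i)]].

Definition integral_points : set 'rV[R]_n :=
  [set x | forall i, x 0 i \is a Num.int].

Definition lattice_basis (B : seq 'rV[R]_n) (L : set 'rV[R]_n) : Prop :=
  free B /\ L = [set x | inIntSpan (in_tuple B) x].

Definition maximal_free (B : seq 'rV[R]_n) A : Prop :=
  [/\ forall e, e \in B -> A e, free B & forall e, A e -> ~~ free (e :: B)].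

Definition edge_vectors (k : nat) (v : 'I_k -> 'rV[R]_n) : set 'rV[R]_n :=
  [set e | exists i j, e = v i - v j].

Definition unimodular_simplex T : Prop :=
  exists (k : nat) (v : 'I_k -> 'rV[R]_n),
    [/\ simplex_on v T, forall i, integral_points (v i)
      & exists B : seq 'rV[R]_n, maximal_free B (edge_vectors v) /\
          lattice_basis B (lin T `&` integral_points)].

Definition subdivision P (S : set (set 'rV[R]_n)) : Prop :=
  [/\ finite_set S,
      forall Q, S Q -> polytope Q,
      \bigcup_(Q in S) Q = P,
      forall Q F, S Q -> face Q F -> S F
    & forall Q1 Q2, S Q1 -> S Q2 ->
        face Q1 (Q1 `&` Q2) /\ face Q2 (Q1 `&` Q2)].

Definition triangulation P (S : set (set 'rV[R]_n)) : Prop :=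
  subdivision P S /\ forall T, S T -> simplex T.

Definition unimodular_triangulation P (S : set (set 'rV[R]_n)) : Prop :=
  triangulation P S /\ forall T, S T -> unimodular_simplex T.

End ConvexGeometry.

Section Regular.
Variables (R : realType) (n : nat).

Definition lift_point (f : 'rV[R]_n -> R) (x : 'rV[R]_n) : 'rV[R]_(n + 1) :=
  row_mx x (f x)%:M.

(* c = (d, h) with d in R^n and last coefficient h. *)
Definition lower_face (Q F : set 'rV[R]_(n + 1)) : Prop :=
  exists (d : 'rV[R]_n) (h b : R), 0 < h /\ face_by (row_mx d h%:M) b Q F.

Definition induced_subdivision (A : set 'rV[R]_n) (f : 'rV[R]_n -> R) :
    set (set 'rV[R]_n) :=
  [set lsubmx @` F | F in lower_face (conv (lift_point f @` A))].

(* f is total, but only its values on A matter. *)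
Definition regular (P : set 'rV[R]_n) (S : set (set 'rV[R]_n)) : Prop :=
  exists (A : set 'rV[R]_n) (f : 'rV[R]_n -> R),
    [/\ finite_set A, A `<=` P, vertex P `<=` A & S = induced_subdivision A f].

Definition independence_polytope (M : matroid 'I_n) : set 'rV[R]_n :=
  conv [set x | exists2 I : {set 'I_n}, independent M I & x = chi R I].

End Regular.
Arguments independence_polytope R {n} M.

(* Main.v *)
Require Import Defs.
From mathcomp Require Import all_boot all_order all_algebra.
From mathcomp Require Import boolp classical_sets functions cardinality reals.
From mathcomp Require Import ring lra zify.

Set Implicit Arguments.
Unset Strict Implicit.
Unset Printing Implicit Defensive.

Import Order.TTheory GRing.Theory Num.Theory.

Local Open Scope ring_scope.

(** The triangulation is induced by the restriction to the indicator vectors of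
    the independent sets of a quadratic form [\sum_(i < j) s_ij x_i x_j], whose
    coefficients have pairwise different orders of magnitude, decreasing when [i]
    increases ([gap], [height]).

    The vertices of a cell are the independent sets that minimize the height plus
    a linear form.  The cells are unimodular simplices as soon as, for each of
    them, the vectors [(1, chi_I)] with [I] a vertex of the cell form a basis of
    the lattice of integral points of their span ([unimodular_family],
    [unimodular_simplex_hull]).  This is proved for all families of sets with the
    symmetric exchange property, which independent sets have
    ([exchange_independent]), by splitting a cell into the members [W0] without
    and [W1] with an element [k] ([unimodular_cell]).  On the members without
    [k], the terms of the height that involve [x_k] vanish; on the others, they
    are a linear form [s].  Hence [W0] and [W1] are cells for the remaining, much
    smaller, height and for linear forms [f] and [f + s].  They are unimodular by
    induction, and it remains to see that together they are still unimodular
    ([unimodular_join]).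

    If the remaining height were zero, [W0] and [W1] would be faces of the
    corresponding polytopes; the exchange property makes the edges of these
    parallel to some [e_i - e_j] or [e_i], so their directions are cut out by
    prescribing the sums of the coordinates over the classes of a partition.  The
    coordinates in one class have about the same coefficient in [f], respectively
    in [f + s].  That remains true for a small height ([cell_class_eq]).  Take the
    classes of both partitions as vertices of a bipartite graph and the
    coordinates as its edges.  As the values of [s] are far apart, a cycle is
    impossible: the largest value of [s] on it could not be compensated by the
    other ones.  Since the incidence matrix of a forest is unimodular, a vector
    with integral sums over all classes is integral ([integral_of_classes]), which
    separates the contributions of [W0] and [W1] in an integral combination.

    That the projected lower faces form a subdivision is shown for arbitrary
    finite point configurations ([regular_cells_subdivision]).  They cover the
    convex hull by linear programming duality ([lp_duality]), which follows from
    Farkas' lemma. *)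

(** * Exchange properties of the independent sets of a matroid *)

Lemma independentP (E : finType) (M : matroid E) (I : {set E}) :
  reflect (exists2 B, B \in bases M & I \subset B) (independent M I).
Proof. exact: exists_inP. Qed.

Lemma independentS (E : finType) (M : matroid E) (I J : {set E}) :
  I \subset J -> independent M J -> independent M I.
Proof.
move=> sIJ /independentP[B MB sJB]; apply/independentP.
by exists B => //; apply: fintype.subset_trans sJB.
Qed.

Lemma card_bases (E : finType) (M : matroid E) (B1 B2 : {set E}) :
  B1 \in bases M -> B2 \in bases M -> #|B1| = #|B2|.
Proof.
move=> MB1 MB2; have [m] := ubnP #|B1 :\: B2|.
elim: m B1 MB1 => // m IHm B1 MB1; rewrite ltnS => le_m.
have [sB12 | /finset.set0Pn[x xB12]] := eqVneq (B1 :\: B2) finset.set0.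
  suff sB21 : B2 :\: B1 == finset.set0.
    suff -> : B1 = B2 by [].
    by apply/eqP; rewrite finset.eqEsubset -!finset.setD_eq0 sB12 eqxx.
  apply/finset.set0Pn => -[x xB21].
  by have [y] := basis_exchange MB2 MB1 xB21; rewrite sB12 finset.in_set0.
have [y yB21 MB1'] := basis_exchange MB1 MB2 xB12.
move: (xB12) (yB21); rewrite !finset.in_setD => /andP[xB2 xB1] /andP[yB1 yB2].
rewrite -(IHm _ MB1').
  by rewrite cardsU1 !finset.inE (negbTE yB1) andbF (cardsD1 x B1) xB1.
apply: leq_trans le_m; apply: proper_card; apply/fintype.properP; split.
  apply/fintype.subsetP=> z; rewrite !finset.inE => /andP[zB2].
  by case/predU1P=> [zy|/andP[_ ->]]; [rewrite zy yB2 in zB2 | rewrite zB2].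
by exists x => //; rewrite !finset.inE eqxx xB2 orbF; apply: contraNneq yB1 => <-.
Qed.

(** An independent set extends to a basis using only elements of a given
    basis. *)
Lemma independent_extend_basis (E : finType) (M : matroid E) (I B : {set E}) :
  independent M I -> B \in bases M ->
  exists2 B', B' \in bases M & (I \subset B') && (B' \subset I :|: B).
Proof.
move=> /independentP[B1 + +] MB; have [m] := ubnP #|B1 :\: (I :|: B)|.
elim: m B1 => // m IHm B1; rewrite ltnS => le_m MB1 sIB1.
have [/eqP sB1 | /finset.set0Pn[x]] := eqVneq (B1 :\: (I :|: B)) finset.set0.
  by exists B1 => //; rewrite sIB1 -finset.setD_eq0.
rewrite finset.in_setD finset.in_setU negb_or -andbA => /and3P[xI xB xB1].
have [|y] := basis_exchange (x := x) MB1 MB; first by rewrite finset.in_setD xB.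
rewrite finset.in_setD => /andP[yB1 yB] MB1'; apply: IHm MB1' _.
  apply: leq_trans le_m; apply: proper_card; apply/fintype.properP; split.
    apply/fintype.subsetP=> z; rewrite !finset.inE negb_or -andbA => /and3P[-> zB] /=.
    by case/predU1P=> [zy|/andP[_ ->]]; rewrite ?zB //; rewrite zy yB in zB.
  exists x; rewrite !finset.inE ?negb_or ?xI ?xB //= eqxx orbF.
  by apply: contraNneq yB1 => <-.
apply/fintype.subsetP=> z zI; rewrite !finset.inE (fintype.subsetP sIB1 z zI) andbT.
by apply/orP; right; apply: contraTneq zI => ->.
Qed.

Lemma independent_augment (E : finType) (M : matroid E) (I J : {set E}) :
  independent M I -> independent M J -> (#|I| < #|J|)%N ->
  exists2 x, x \in J :\: I & independent M (x |: I).
Proof.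
move=> indI /independentP[B MB sJB] ltIJ.
have [B' MB' /andP[sIB' sB'U]] := independent_extend_basis indI MB.
have [x /[!finset.inE] /andP[xB' /andP[xI xJ]]] : exists x, x \in B' :&: (J :\: I).
  apply/finset.set0Pn; apply: contraTneq ltIJ => JI0; rewrite -leqNgt.
  have : B' :\: I \subset B :\: J.
    apply/fintype.subsetP=> z /[!finset.inE] /andP[zI zB'].
    move: (fintype.subsetP sB'U z zB'); rewrite finset.inE (negPf zI) /= => ->.
    rewrite andbT; apply/negP=> zJ.
    have : z \in B' :&: (J :\: I) by rewrite !finset.inE zB' zI zJ.
    by rewrite JI0 finset.in_set0.
  move/subset_leq_card; rewrite !cardsDS // (card_bases MB' MB).
  have := subset_leq_card sJB; lia.
exists x; first by rewrite finset.inE xI.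
by apply/independentP; exists B' => //; rewrite finset.subUset finset.sub1set xB'.
Qed.

Lemma independent_extend (E : finType) (M : matroid E) (I J : {set E}) :
  independent M I -> independent M J -> (#|I| <= #|J|)%N ->
  exists Y, [/\ independent M Y, I \subset Y, Y \subset I :|: J & #|Y| = #|J|].
Proof.
move=> + indJ; have [m] := ubnP (#|J| - #|I|)%N.
elim: m I => // m IHm I lem indI; rewrite leq_eqVlt => /predU1P[eqIJ|ltIJ].
  by exists I; rewrite indI finset.subsetUl eqIJ.
have [x /[!finset.inE] /andP[xI xJ] indxI] := independent_augment indI indJ ltIJ.
have cxI : #|x |: I| = #|I|.+1 by rewrite cardsU1 xI.
have [||Y [indY sxIY sYU cY]] := IHm (x |: I) _ indxI; rewrite ?cxI //; first by lia.
exists Y; split=> //; first exact: (fintype.subset_trans (finset.subsetUr _ _) sxIY).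
apply: (fintype.subset_trans sYU); rewrite -finset.setUA finset.subUset fintype.subxx andbT.
by rewrite finset.sub1set finset.inE xJ orbT.
Qed.

(** Symmetric exchange for a family of sets, where an element may also be
    moved without compensation (M-natural convexity in the language of
    discrete convex analysis). *)
Definition exchange (E : finType) (V : {set {set E}}) : Prop :=
  forall (I J : {set E}) i, I \in V -> J \in V -> i \in I :\: J ->
    (I :\ i \in V /\ i |: J \in V) \/
    exists2 j, j \in J :\: I & (j |: (I :\ i) \in V /\ i |: (J :\ j) \in V).

(** If [J + i] is dependent, the elements [j] of [J] with [J + i - j] independent
    are those of its circuit other than [i].  As [i] is spanned by them but not by
    [I - i], one of them is not spanned by [I - i]. *)
Lemma exchange_independent (E : finType) (M : matroid E) :
  exchange [set I | independent M I].
Proof.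
move=> I J i; rewrite !finset.inE => indI indJ /andP[iJ iI].
have indIi : independent M (I :\ i) by apply: independentS indI; apply: finset.subD1set.
have [indJi|depJi] := boolP (independent M (i |: J)); [by left | right].
pose C := [set j in J | independent M (i |: (J :\ j))].
have sCJ : C \subset J by apply/fintype.subsetP=> j /[!finset.inE] /andP[].
have indC : independent M C by apply: independentS indJ.
have depC : ~~ independent M (i |: C).
  apply/negP=> indiC; case: (leqP #|i |: C| #|J|) => [leCJ|].
    have [Y [indY siCY sYU cY]] := independent_extend indiC indJ leCJ.
    have sYiJ : Y \subset i |: J.
      apply: (fintype.subset_trans sYU); rewrite -finset.setUA finset.setUS //.
      by rewrite finset.subUset sCJ fintype.subxx.
    have iY : i \in Y by rewrite (fintype.subsetP siCY) // finset.inE finset.set11.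
    have [sJY|] := boolP (J \subset Y).
      by move/negP: depJi; apply; apply: independentS indY; rewrite finset.subUset finset.sub1set iY.
    case/fintype.subsetPn=> j jJ jY; move/negP: (jY); apply.
    apply: (fintype.subsetP siCY); rewrite !finset.inE jJ /=; apply/orP; right.
    suff -> : i |: (J :\ j) = Y by [].
    apply/esym/eqP; rewrite eqEcard; apply/andP; split.
      apply/fintype.subsetP=> z zY; move: (fintype.subsetP sYiJ z zY); rewrite !finset.inE.
      by case/predU1P=> [->|->]; rewrite ?eqxx // andbT (contraNneq _ jY) ?orbT // => <-.
    by rewrite cY cardsU1 !finset.inE (negPf iJ) andbF (cardsD1 j J) jJ.
  have iC : i \notin C by apply: contraNN iJ => /(fintype.subsetP sCJ).
  rewrite cardsU1 iC ltnS => leJC; move/negP: depJi; apply.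
  by have /eqP <- : C == J by rewrite eqEcard sCJ.
have [/exists_inP[j jJI indj]|] := boolP [exists j in J :\: I,
    independent M (j |: (I :\ i)) && independent M (i |: (J :\ j))].
  by exists j => //; rewrite !finset.inE; apply/andP.
move=> noj; exfalso.
(* Otherwise [I - i] is maximal independent in [I - i + C]. *)
have max_Ii (Y : {set E}) : independent M Y -> Y \subset I :|: C -> i \notin Y ->
    (#|Y| < #|I|)%N.
  move=> indY sYU iY; rewrite ltnNge; apply/negP=> leIY.
  have [|j /[!finset.inE] /andP[jIi jY] indj] := independent_augment indIi indY.
    by apply: leq_trans leIY; rewrite (cardsD1 i I) iI.
  have jI : j \notin I.
    by apply: contraNN jIi => ->; rewrite andbT; apply: contraNneq iY => <-.
  have jC : j \in C by move: (fintype.subsetP sYU j jY); rewrite finset.in_setU (negPf jI).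
  move/negP: noj; apply; apply/exists_inP; exists j; last first.
    by rewrite indj; move: jC; rewrite finset.inE => /andP[].
  by rewrite finset.inE jI (fintype.subsetP sCJ).
have iC : i \notin C by apply: contraNN iJ => /(fintype.subsetP sCJ).
have ltCI := max_Ii C indC (finset.subsetUr _ _) iC.
have [Y [indY sCY sYU cY]] := independent_extend indC indI (ltnW ltCI).
have iY : i \in Y.
  by apply: contraT => iY; have := max_Ii Y indY _ iY; rewrite cY ltnn finset.setUC; apply.
case/negP: depC; apply: independentS indY.
by rewrite finset.subUset finset.sub1set iY.
Qed.

(** * Potentials on a bipartite graph and integrality *)

Lemma connect_dist (R : numDomainType) (T : finType) (r : rel T) (f : T -> R) (c : R) (x y : T) :
  0 <= c -> (forall a b, r a b -> `|f a - f b| <= c) -> connect r x y ->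
  `|f x - f y| <= #|T|%:R * c.
Proof.
move=> c0 rc /connectP[p0 /shortenP[p xp uxp _] ->].
have : (size p <= #|T|)%N.
  by apply: ltnW; rewrite -[X in (X <= _)%N](card_uniqP uxp) max_card.
rewrite -(ler_nat R) => /(ler_wpM2r c0); apply: le_trans.
elim: p x xp {uxp} => [|a p IHp] x /=; first by rewrite subrr normr0 mul0r.
case/andP=> rxa /IHp IH; apply: (le_trans (ler_distD (f a) _ _)).
by rewrite -[(size p).+1]addn1 natrD mulrDl mul1r addrC lerD // rc.
Qed.

(** The elements of [G] are the edges of a bipartite graph whose vertices are
    the classes of [e0] and of [e1]; up to [K], an edge [g] joins a class at
    potential [f g] to a class at potential [f g + s g].  Among the edges with
    non-integral value the one with the largest gap [s] is a bridge, hence its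
    value is a signed sum of the values of whole classes. *)
Lemma integral_of_classes (R : realType) (G : finType) (e0 e1 : rel G)
    (f s : G -> R) (K : R) (y : G -> R) :
  reflexive e0 -> transitive e0 -> reflexive e1 -> transitive e1 ->
  (forall a b, e0 a b -> `|f a - f b| <= K) ->
  (forall a b, e1 a b -> `|(f a + s a) - (f b + s b)| <= K) ->
  (forall X : {set G}, (forall a b, e0 a b -> a \in X -> b \in X) ->
     \sum_(g in X) y g \is a Num.int) ->
  (forall X : {set G}, (forall a b, e1 a b -> a \in X -> b \in X) ->
     \sum_(g in X) y g \is a Num.int) ->
  0 <= K -> (forall g, 0 <= s g) ->
  (forall a b, y a \isn't a Num.int -> y b \isn't a Num.int -> a != b ->
     s a <= s b -> #|G|.+1%:R * (K + s a) < s b) ->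
  forall g, y g \is a Num.int.
Proof.
move=> r0 t0 r1 t1 f0 f1 H0 H1 K0 s0 Hs g0; apply: contraT => g0D.
pose D := [set g | y g \isn't a Num.int].
have g0D' : g0 \in D by rewrite finset.inE.
have [d dD dmax] : exists2 d, d \in D & forall x, x \in D -> s x <= s d.
  by case: (@arg_maxP _ _ _ g0 (mem D) s g0D') => d dD dmax; exists d.
pose c := s d / #|G|.+1%:R.
have N0 : 0 < #|G|.+1%:R :> R by rewrite ltr0n.
have c0 : 0 <= c by rewrite divr_ge0 // ltW.
have Kc x : x \in D -> x != d -> K + s x < c.
  move=> xD xd; rewrite ltr_pdivlMr // mulrC; move: (xD) (dD); rewrite !finset.inE => xD' dD'.
  exact: Hs (dmax x xD).
(* [r]-paths out of [d] leave [d] through its [e0]-class only. *)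
pose r := [rel a b | [&& a \in D, b \in D, b != d & e0 a b || (a != d) && e1 a b]].
have rc a b : r a b -> `|f a - f b| <= c.
  case/and4P=> aD bD bd /orP[/f0 /le_trans|/andP[ad /f1]].
    by apply; apply: (le_trans _ (ltW (Kc b bD bd))); rewrite lerDl.
  have := Kc a aD ad; have := Kc b bD bd; have := s0 a; have := s0 b.
  rewrite !ler_norml; lra.
pose C := [set x | connect r d x].
have dC : d \in C by rewrite finset.inE connect0.
have CD x : x \in C -> x \in D.
  rewrite finset.inE => /connectP[p + ->]; elim/last_ind: p => [|p z _] //=.
  by rewrite rcons_path last_rcons => /andP[_ /and4P[]].
have Cr x z : x \in C -> r x z -> z \in C.
  rewrite !finset.in_set => dx xz; apply: connect_trans dx _; exact: connect1.
have int_sum (X Y : {set G}) : \sum_(g in X) y g \is a Num.int -> X :&: D = Y ->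
    \sum_(g in Y) y g \is a Num.int.
  move=> + <-; rewrite (big_setID D) /= rpredDr //.
  by apply: rpred_sum => g; rewrite finset.in_setD finset.inE negbK => /andP[].
have closure_class (e : rel G) (Y : {set G}) : transitive e ->
    forall a b, e a b -> a \in [set x | [exists z in Y, e z x]] ->
      b \in [set x | [exists z in Y, e z x]].
  move=> te a b eab; rewrite !finset.inE => /exists_inP[z zY eza].
  by apply/exists_inP; exists z => //; apply: te eab.
have C_int : \sum_(g in C) y g \is a Num.int.
  apply: int_sum (H0 _ (closure_class e0 C t0)) _.
  apply/setP=> x; rewrite finset.in_setI finset.in_set; apply/andP/idP=> [[/exists_inP[z zC e0zx] xD]|xC].
    have [-> //|xd] := eqVneq x d.
    by apply: (Cr z) => //; apply/and4P; split; rewrite ?e0zx ?(CD z).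
  by split; [apply/exists_inP; exists x => // | apply: CD].
have Cd_int : \sum_(g in C :\ d) y g \is a Num.int.
  apply: int_sum (H1 _ (closure_class e1 (C :\ d) t1)) _.
  apply/setP=> x; rewrite finset.in_setI finset.in_set finset.in_setD1.
  apply/andP/andP=> [[/exists_inP[z]]|[xd xC]]; last first.
    by split; [apply/exists_inP; exists x; rewrite ?finset.in_setD1 ?xd | apply: CD].
  rewrite finset.in_setD1 => /andP[zd zC] e1zx xD.
  have [xd|xd] := eqVneq x d; last first.
    by split=> //; apply: (Cr z) => //; apply/and4P; split; rewrite ?zd ?e1zx ?orbT ?(CD z).
  move: zC (zC); rewrite {1}finset.inE => /(connect_dist c0 rc) + /CD zD.
  have := Kc z zD zd; have := f1 _ _ e1zx; rewrite xd.
  have : s d = #|G|%:R * c + c by rewrite -[X in _ + X]mul1r -mulrDl natr1 mulrC divfK // gt_eqF.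
  have := s0 z; move: (#|G|%:R * c) => w.
  rewrite !ler_norml; lra.
have : y d \is a Num.int by move: C_int; rewrite (big_setD1 d dC) /= rpredDr.
by move: dD; rewrite finset.inE => /negP.
Qed.

(** * Minimizers of nearly linear functions on exchange families *)

(** The value at the indicator vector of [w], completed by the coordinate
    [- #|w|] at [None] so that its coordinates sum to [0], of the linear form
    with coefficients [f].  A removal, an addition or a swap of elements then all
    have the effect of moving one unit between two coordinates. *)
Definition hval (R : comNzRingType) (E : finType) (f : option E -> R) (w : {set E}) : R :=
  \sum_(i in w) (f (Some i) - f None).

(** The number of elements in exactly one of two sets. *)
Definition setdist (E : finType) (a b : {set E}) : nat := #|(a :\: b) :|: (b :\: a)|.

Lemma setdist_lt (E : finType) (a b c : {set E}) (i : E) :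
  (i \in a) != (i \in b) -> (i \in c) = (i \in b) ->
  (forall z, (z \in c) != (z \in b) -> (z \in a) != (z \in b)) ->
  (setdist c b < setdist a b)%N.
Proof.
have dE (u v : {set E}) z : (z \in (u :\: v) :|: (v :\: u)) = ((z \in u) != (z \in v)).
  by rewrite !finset.inE; case: (z \in u); case: (z \in v).
move=> iab icb sub; apply: proper_card; apply/fintype.properP; split.
  by apply/fintype.subsetP=> z; rewrite !dE; apply: sub.
by exists i; rewrite !dE // icb eqxx.
Qed.

Lemma hvalD1 (R : comNzRingType) (E : finType) (f : option E -> R) (w : {set E}) i :
  i \in w -> hval f (w :\ i) = hval f w - f (Some i) + f None.
Proof. by move=> iw; rewrite /hval (big_setD1 i iw) /=; ring. Qed.

Lemma hvalU1 (R : comNzRingType) (E : finType) (f : option E -> R) (w : {set E}) i :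
  i \notin w -> hval f (i |: w) = hval f w + f (Some i) - f None.
Proof. by move=> iw; rewrite /hval big_setU1 //=; ring. Qed.

Lemma exchange_slice (E : finType) (V : {set {set E}}) (k : E) (c : bool) :
  exchange V -> exchange [set w in V | (k \in w) == c].
Proof.
move=> exV I J i; rewrite !finset.in_set => /andP[VI /eqP kI] /andP[VJ /eqP kJ] iIJ.
have /andP[iJ iI] := iIJ.
have ki : k != i by apply: contraNneq iJ => ki; rewrite -ki kJ -kI ki.
have iIJ' : i \in I :\: J by rewrite finset.in_setD.
case: (exV I J i VI VJ iIJ') => [[V1 V2]|[j jJI [V1 V2]]]; [left|right].
  by rewrite V1 V2 !finset.inE (negPf ki) /= kI kJ.
exists j => //; have := jJI; rewrite finset.inE => /andP[jI jJ].
have kj : k != j by apply: contraNneq jI => kj; rewrite -kj kI -kJ kj.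
by rewrite !finset.in_set V1 V2 !finset.inE (negPf ki) (negPf kj) /= kI kJ.
Qed.

Lemma exchange_step (R : comNzRingType) (E : finType) (V : {set {set E}}) (a a' : {set E}) :
  exchange V -> a \in V -> a' \in V -> a != a' ->
  exists (g g' : option E) (c c' : {set E}),
    [/\ c \in V, c' \in V, (setdist c a' < setdist a a')%N
      & forall f : option E -> R,
          hval f c = hval f a - f g + f g' /\ hval f c' = hval f a' + f g - f g'].
Proof.
move=> exV aV a'V neq; have [a0 | /finset.set0Pn[i iaa']] := eqVneq (a :\: a') finset.set0.
  have /finset.set0Pn[i ia'a] : a' :\: a != finset.set0.
    apply: contraNneq neq => a'0.
    by rewrite finset.eqEsubset -!finset.setD_eq0 a0 a'0 eqxx.
  move: (ia'a); rewrite finset.inE => /andP[ia ia'].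
  case: (exV a' a i a'V aV ia'a) => [[V1 V2]|[j]]; last by rewrite a0 finset.in_set0.
  exists None, (Some i), (i |: a), (a' :\ i); split=> //; last first.
    by move=> f; rewrite hvalD1 // hvalU1 //; split; ring.
  apply: (@setdist_lt _ _ _ _ i); rewrite ?finset.inE ?eqxx ?(negPf ia) ?ia' // => z.
  by rewrite !finset.inE; case: (eqVneq z i) => [->|_] //; rewrite ia'.
move: (iaa'); rewrite finset.inE => /andP[ia' ia].
case: (exV a a' i aV a'V iaa') => [[V1 V2]|[j jaa' [V1 V2]]].
  exists (Some i), None, (a :\ i), (i |: a'); split=> //; last first.
    by move=> f; rewrite hvalD1 // hvalU1 //; split; ring.
  apply: (@setdist_lt _ _ _ _ i); rewrite ?finset.inE ?eqxx ?(negPf ia') ?ia // => z.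
  by rewrite !finset.inE; case: (eqVneq z i) => [->|_] //; rewrite (negPf ia').
move: (jaa'); rewrite finset.inE => /andP[ja ja'].
have ij : i != j by apply: contraNneq ja => <-.
exists (Some i), (Some j), (j |: (a :\ i)), (i |: (a' :\ j)); split=> //; last first.
  move=> f; rewrite !hvalU1 ?hvalD1 ?finset.inE ?(negPf ja) ?(negPf ia') ?andbF //.
  by split; ring.
apply: (@setdist_lt _ _ _ _ i).
- by rewrite (negPf ia') ia.
- by rewrite !finset.inE eqxx (negPf ij) (negPf ia').
move=> z; rewrite !finset.inE; case: (eqVneq z j) => [->|_]; first by rewrite ja'.
by case: (eqVneq z i) => [->|_] //; rewrite (negPf ia').
Qed.

(** [b] is a lower bound on [V] for [om] plus the linear form [f]. *)
Definition supports (R : realType) (E : finType) (V : {set {set E}})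
    (om : {set E} -> R) (f : option E -> R) (b : R) : Prop :=
  forall w, w \in V -> b <= om w + hval f w.

(** The members of [V] at which the lower bound [b] of [om] plus a linear form is
    attained: the vertices of a cell of the subdivision with heights [om]. *)
Definition cell (R : realType) (E : finType) (V : {set {set E}})
    (om : {set E} -> R) (f : option E -> R) (b : R) : {set {set E}} :=
  [set w in V | om w + hval f w == b].

(** When [om] is small, two members of a cell are joined by exchanges along which
    [f] is almost constant, so they have the same total on each union [X] of
    classes of the relation that links coordinates with close coefficients.
    Each exchange towards [a'] loosens minimality by at most [2 * Om]. *)
Lemma cell_class_eq (R : realType) (E : finType) (V : {set {set E}})
    (om : {set E} -> R) (f : option E -> R) (b Om : R) (X : {set option E}) a a' :
  exchange V -> (forall w, w \in V -> 0 <= om w <= Om) -> supports V om f b ->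
  (forall g g', `|f g - f g'| <= (2 * #|E| + 1)%:R * Om -> g \in X -> g' \in X) ->
  a \in cell V om f b -> a' \in cell V om f b ->
  hval (fun g => (g \in X)%:R : R) a = hval (fun g => (g \in X)%:R) a'.
Proof.
move=> exV omV sup clX + /[!finset.in_set] /andP[a'V /eqP a'b].
suff H (m : nat) : forall u : {set E}, u \in V -> (setdist u a' < m)%N -> forall t : R,
    om u + hval f u <= b + t -> t + (2 * setdist u a' + 1)%:R * Om <= (2 * #|E| + 1)%:R * Om ->
    hval (fun g => (g \in X)%:R : R) u = hval (fun g => (g \in X)%:R) a'.
  rewrite finset.in_set => /andP[aV /eqP ab]; apply: (H _ a aV (ltnSn _) 0); rewrite ?addr0 ?ab ?add0r //.
  have /andP[/le_trans H1 /H1 Om0] := omV _ aV.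
  by apply: ler_wpM2r => //; rewrite ler_nat leq_add2r leq_mul2l /= max_card.
elim: m => // m IHm u uV; rewrite ltnS => le_m t ut tle.
have [-> //|neq] := eqVneq u a'.
have [g [g' [c [c' [cV c'V lt cE]]]]] := exchange_step R exV uV a'V neq.
have [cX _] := cE (fun g => (g \in X)%:R); have [cf c'f] := cE f.
have := omV _ cV; have := omV _ c'V; have := omV _ uV; have := omV _ a'V.
have := sup _ cV; have := sup _ c'V; have := sup _ uV.
rewrite cf c'f => su sc' sc /andP[oa0 oa] /andP[ou0 ou] /andP[oc'0 oc'] /andP[oc0 oc].
have Om0 := le_trans ou0 ou.
have H2 : t + 2 * Om + (2 * setdist c a' + 1)%:R * Om <= (2 * #|E| + 1)%:R * Om.
  apply: le_trans tle; rewrite -addrA lerD2l -mulrDl ler_wpM2r //.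
  by rewrite -natrD ler_nat addnA leq_add2r -[X in (X + _)%N]muln1 -mulnDr leq_mul2l.
have Hgg : `|f g - f g'| <= (2 * #|E| + 1)%:R * Om.
  have : (1 : R) * Om <= (2 * setdist c a' + 1)%:R * Om by rewrite ler_wpM2r // ler1n addn1.
  rewrite ler_norml; move: a'b su sc' sc H2 ut.
  move: ((2 * setdist c a' + 1)%:R * Om) ((2 * #|E| + 1)%:R * Om) => v1 v2.
  lra.
have Hgg' : `|f g' - f g| <= (2 * #|E| + 1)%:R * Om by rewrite distrC.
have gX : (g \in X) = (g' \in X) by apply/idP/idP; [apply: clX Hgg | apply: clX Hgg'].
rewrite -(IHm c cV _ (t + 2 * Om)) ?cX ?gX ?subrK //.
- exact: leq_trans lt le_m.
- rewrite cf; move: a'b su sc' sc ut; lra.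
Qed.

(** * Unimodularity of the cells *)

(** The vectors [(1, chi_w)], [w] in [W], form a basis of the lattice of integral
    points of their linear span. *)
Definition unimodular_family (R : realType) (E : finType) (W : {set {set E}}) : Prop :=
  forall a : {set E} -> R,
    \sum_(w in W) a w \is a Num.int ->
    (forall i, \sum_(w in W | i \in w) a w \is a Num.int) ->
    forall w, w \in W -> a w \is a Num.int.

Lemma hval_sum (R : comNzRingType) (E I : finType) (P : pred I) (F : I -> option E -> R) w :
  hval (fun g => \sum_(i | P i) F i g) w = \sum_(i | P i) hval (F i) w.
Proof. by rewrite /hval exchange_big; apply: eq_bigr => i _; rewrite sumrB. Qed.

Lemma hvalD (R : comNzRingType) (E : finType) (f f' : option E -> R) w :
  hval (fun g => f g + f' g) w = hval f w + hval f' w.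
Proof. by rewrite /hval -big_split; apply: eq_bigr => i _ /=; ring. Qed.

Lemma hval_int (R : realType) (E : finType) (f : option E -> R) (w : {set E}) :
  (forall g, f g \is a Num.int) -> hval f w \is a Num.int.
Proof. by move=> fint; apply: rpred_sum => i _; rewrite rpredB. Qed.

Lemma sum_hval_int (R : realType) (E : finType) (W : {set {set E}})
    (a : {set E} -> R) (f : option E -> R) :
  (forall i, \sum_(w in W | i \in w) a w \is a Num.int) ->
  (forall g, f g \is a Num.int) -> \sum_(w in W) a w * hval f w \is a Num.int.
Proof.
move=> aint fint.
have -> : \sum_(w in W) a w * hval f w =
    \sum_i (f (Some i) - f None) * \sum_(w in W | i \in w) a w.
  under eq_bigr do rewrite mulr_sumr; rewrite (exchange_big_dep xpredT) //=.
  by apply: eq_bigr => i _; rewrite mulr_sumr; apply: eq_bigr => w _; rewrite mulrC.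
by apply: rpred_sum => i _; rewrite rpredM ?rpredB.
Qed.

Lemma sum_hval1 (R : realType) (E : finType) (W : {set {set E}}) (a : {set E} -> R) i :
  \sum_(w in W) a w * hval (fun g => (g == Some i)%:R) w = \sum_(w in W | i \in w) a w.
Proof.
rewrite [RHS]big_mkcondr; apply: eq_bigr => w _; rewrite /hval.
under eq_bigr do rewrite subr0.
rewrite (big_mkcond (mem w)) (bigD1 i) //= eqxx big1 => [|j /negPf ji].
  by rewrite addr0; case: (i \in w); rewrite ?mulr1 ?mulr0.
by rewrite (inj_eq Some_inj) ji; case: ifP.
Qed.

(** Coefficients close to each other, linked in chains. *)
Definition near_rel (R : numDomainType) (T : finType) (f : T -> R) (K : R) : rel T :=
  connect (fun x y => `|f x - f y| <= K).

(** [g |-> \sum_w a w * hval _ w] is the [g]-coordinate of the combination with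
    coefficients [a] of the completed indicator vectors; by [cell_class_eq], its sum
    over [X] is [\sum_w a w] times an integer. *)
Lemma sum_class_int (R : realType) (E : finType) (V : {set {set E}})
    (om : {set E} -> R) (f : option E -> R) (b Om : R) (a : {set E} -> R) (X : {set option E}) :
  exchange V -> (forall w, w \in V -> 0 <= om w <= Om) -> supports V om f b ->
  \sum_(w in cell V om f b) a w \is a Num.int ->
  (forall g g', near_rel f ((2 * #|E| + 1)%:R * Om) g g' -> g \in X -> g' \in X) ->
  \sum_(g in X) \sum_(w in cell V om f b) a w * hval (fun g' => (g' == g)%:R) w \is a Num.int.
Proof.
move=> exV omV sup aint clX; rewrite exchange_big /=.
have -> : \sum_(w in cell V om f b) \sum_(g in X) a w * hval (fun g' => (g' == g)%:R) w =
    \sum_(w in cell V om f b) a w * hval (fun g => (g \in X)%:R) w.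
  apply: eq_bigr => w _; rewrite -mulr_sumr -hval_sum; congr (_ * hval _ w).
  apply/funext => g'; have [g'X|g'X] := boolP (g' \in X).
    by rewrite (bigD1 g') //= eqxx big1 ?addr0 // => g /andP[_ /negPf]; rewrite eq_sym => ->.
  by rewrite big1 // => g gX; rewrite (negPf (contraNneq _ g'X)) // => ->.
have [[w0 w0W]|W0] := pselect (exists w, w \in cell V om f b); last first.
  by rewrite big1 ?rpred0 // => w wW; case: W0; exists w.
have clX' : forall g g', `|f g - f g'| <= (2 * #|E| + 1)%:R * Om -> g \in X -> g' \in X.
  by move=> g g' gg'; apply: clX; apply: connect1.
under eq_bigr => w wW do rewrite (cell_class_eq exV omV sup clX' wW w0W).
by rewrite -mulr_suml rpredM // hval_int // => g; case: (g \in X); rewrite ?rpred0 ?rpred1.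
Qed.

(** Splitting a cell along an element [k]: the parts without and with [k] are
    cells for potentials that differ by [sg].  If the gaps [sg] are far apart
    compared with [om'], the two parts together are unimodular as soon as each of
    them is. *)
Lemma unimodular_join (R : realType) (E : finType) (V : {set {set E}}) (k : E)
    (om om' : {set E} -> R) (sg f : option E -> R) (b Om K : R) :
  exchange V -> (forall w, w \in V -> 0 <= om' w <= Om) ->
  (forall w, w \in V -> om w = om' w + (if k \in w then hval sg w else 0)) ->
  K = #|{: option E}|%:R * ((2 * #|E| + 1)%:R * Om) -> 0 <= Om ->
  (forall g, 0 <= sg g) ->
  (forall g g' : option E, g != g' -> sg g <= sg g' ->
     (forall i, g = Some i \/ g' = Some i ->
        exists w w', [/\ w \in V, w' \in V & (i \in w) != (i \in w')] /\
                     (k \notin w) && (k \notin w')) ->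
     #|{: option E}|.+1%:R * (K + sg g) < sg g') ->
  supports V om f b ->
  unimodular_family R (cell [set w in V | (k \in w) == false] om' f b) ->
  unimodular_family R (cell [set w in V | (k \in w) == true] om' (fun g => f g + sg g) b) ->
  unimodular_family R (cell V om f b).
Proof.
move=> exV om'V omE KE Om0 sg0 sep sup.
set V0 := [set w in V | _ == false]; set V1 := [set w in V | _ == true].
set W0 := cell V0 _ _ _; set W1 := cell V1 _ _ _; set W := cell V om f b.
have inW0 w : (w \in W0) = (w \in W) && (k \notin w).
  rewrite !finset.in_set; have [wV|//] := boolP (w \in V).
  by rewrite (omE w wV); case: (k \in w); rewrite ?andbF //= andbT addr0.
have inW1 w : (w \in W1) = (w \in W) && (k \in w).
  rewrite !finset.in_set; have [wV|//] := boolP (w \in V).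
  by rewrite (omE w wV) hvalD; case: (k \in w); rewrite ?andbF //= andbT; congr (_ == _); ring.
move=> u0 u1 a aint aiint.
have splitW (P : pred {set E}) (F : {set E} -> R) : \sum_(w in W | P w) F w =
    \sum_(w in W0 | P w) F w + \sum_(w in W1 | P w) F w.
  rewrite (bigID (fun w : {set E} => k \in w)) /= addrC; congr (_ + _); apply: eq_bigl => w.
    by rewrite inW0 -!andbA; congr (_ && _); rewrite andbC.
  by rewrite inW1 -!andbA; congr (_ && _); rewrite andbC.
have splitWT (F : {set E} -> R) : \sum_(w in W) F w = \sum_(w in W0) F w + \sum_(w in W1) F w.
  have TE (U : {set {set E}}) : \sum_(w in U) F w = \sum_(w in U | xpredT w) F w.
    by apply: eq_bigl => w; rewrite andbT.
  by rewrite !TE splitW.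
have S1 : \sum_(w in W1) a w \is a Num.int.
  by have := aiint k; under eq_bigl do rewrite -inW1.
have S0 : \sum_(w in W0) a w \is a Num.int.
  by move: aint; rewrite splitWT rpredDr.
pose d g g' : R := (g' == g :> option E)%:R.
have dint g g' : d g g' \is a Num.int by rewrite /d; case: eqP; rewrite ?rpred0 ?rpred1.
pose y g := \sum_(w in W0) a w * hval (d g) w.
pose z g := \sum_(w in W1) a w * hval (d g) w.
have yz g : y g + z g \is a Num.int.
  by rewrite /y /z -splitWT; apply: sum_hval_int.
have sup0 : supports V0 om' f b.
  move=> w; rewrite finset.in_set => /andP[wV /eqP kw].
  by have := sup w wV; rewrite omE // kw addr0.
have sup1 : supports V1 om' (fun g => f g + sg g) b.
  move=> w; rewrite finset.in_set => /andP[wV /eqP kw].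
  by have := sup w wV; rewrite omE // kw hvalD; congr (_ <= _); ring.
have V0V w : w \in V0 -> w \in V by rewrite finset.in_set => /andP[].
have V1V w : w \in V1 -> w \in V by rewrite finset.in_set => /andP[].
pose K1 := (2 * #|E| + 1)%:R * Om.
have K10 : 0 <= K1 by rewrite mulr_ge0.
have near_refl (h : option E -> R) : reflexive (near_rel h K1) by move=> x; apply: connect0.
have near_trans (h : option E -> R) : transitive (near_rel h K1).
  by move=> x u v; apply: connect_trans.
have near_dist (h : option E -> R) x x' : near_rel h K1 x x' -> `|h x - h x'| <= K.
  by rewrite KE; apply: connect_dist.
have yint : forall g, y g \is a Num.int.
  apply: (integral_of_classes (e0 := near_rel f K1) (e1 := near_rel (fun g => f g + sg g) K1)
            (f := f) (s := sg) (K := K)) => //.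
  - exact: near_dist.
  - exact: near_dist (fun g => f g + sg g).
  - move=> X clX; apply: sum_class_int clX => //; first exact: exchange_slice.
    by move=> w /V0V; apply: om'V.
  - move=> X clX; have : \sum_(g in X) (y g + z g) \is a Num.int by apply: rpred_sum.
    rewrite big_split /= rpredDr //.
    apply: sum_class_int clX => //; first exact: exchange_slice.
    by move=> w /V1V; apply: om'V.
  - by rewrite KE mulr_ge0.
  - move=> g g' yg yg' gg' sgg'; apply: sep => // i ig.
    have yi : y (Some i) \isn't a Num.int by case: ig => <-.
    apply: contrapT => nw; move/negP: yi; apply; rewrite /y sum_hval1.
    have [[w0 w0W]|] := pselect (exists w, w \in W0); last first.
      by move=> W00; rewrite big1 ?rpred0 // => w /andP[wW _]; case: W00; exists w.
    suff iw w : w \in W0 -> (i \in w) = (i \in w0).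
      case iw0 : (i \in w0).
        rewrite (eq_bigl (mem W0)) // => w; case wW: (w \in W0) => //=.
        by rewrite iw ?iw0.
      by rewrite big1 ?rpred0 // => w /andP[wW]; rewrite iw ?iw0.
    move=> wW; apply/eqP; apply: contraT => iw; case: nw; exists w, w0.
    move: wW w0W; rewrite !inW0 !finset.in_set => /andP[/andP[wV _] ->] /andP[/andP[w0V _] ->].
    by split.
move=> w wW; have [kw|kw] := boolP (k \in w).
  apply: u1 => //; last by rewrite inW1 wW.
  move=> i; rewrite -sum_hval1 -/(d (Some i)) -/(z (Some i)).
  by rewrite -(rpredDl (z (Some i)) (yint (Some i))).
apply: u0 => //; last by rewrite inW0 wW.
by move=> i; rewrite -sum_hval1; apply: yint.
Qed.

(** * The quadratic height function *)

(** A base for the coefficients, large enough for [gap_separation]. *)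
Definition gap_base (n : nat) : nat := ((n + 2) * (n.+1 * ((2 * n + 1) * (n * n)) + 1)).+1.

(** The coefficient of [x_i x_j], for [i < j], in the height function: all these
    coefficients are of different orders of magnitude, and those with first index
    [i] dominate all those with a larger first index. *)
Definition gap (n i j : nat) : nat := gap_base n ^ ((n - i) * n + j).

(** The part of the height function with first indices at least [k], at the
    indicator vector of [w]. *)
Definition height_from (R : realType) (n k : nat) (w : {set 'I_n}) : R :=
  \sum_(i in w | (k <= i)%N) \sum_(j in w | (i < j)%N) (gap n i j)%:R.

(** The linear form that multiplies [x_k] in the height function. *)
Definition gap_form (R : realType) (n k : nat) (g : option 'I_n) : R :=
  if g is Some j then if (k < j)%N then (gap n k j)%:R else 0 else 0.

Lemma height_from_bound (R : realType) (n k : nat) (w : {set 'I_n}) : (k < n)%N ->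
  0 <= height_from R k.+1 w <= (n * n * gap_base n ^ ((n - k) * n).-1)%:R.
Proof.
move=> kn; apply/andP; split; first by apply: sumr_ge0 => i _; apply: sumr_ge0.
set c := (gap_base n ^ _)%N.
have le_c (i j : 'I_n) : (k < i)%N -> (gap n i j <= c)%N.
  move=> ki; apply: leq_pexp2l => //.
  have := ltn_ord j; have : (n - i <= n - k.+1)%N by lia.
  have -> : (n - k = (n - k.+1).+1)%N by lia.
  move=> /(leq_mul (leqnn n)); rewrite mulSn !(mulnC n); lia.
apply: (@le_trans _ _ (\sum_(i < n) \sum_(j < n) c%:R)); last first.
  by rewrite !sumr_const card_ord -!mulrnA ler_nat mulnC.
have sub (P : pred 'I_n) (F G : 'I_n -> R) : (forall i, P i -> F i <= G i) -> (forall i, 0 <= G i) ->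
    \sum_(i | P i) F i <= \sum_i G i.
  move=> FG G0; rewrite [leRHS](bigID P) /= -[leLHS]addr0.
  by apply: lerD; [apply: ler_sum | apply: sumr_ge0].
apply: (sub _ _ _) => [i /andP[_ ki]|i]; last exact: sumr_ge0.
by apply: sub => // j _; rewrite ler_nat le_c.
Qed.

Lemma height_from_split (R : realType) (n : nat) (k : 'I_n) (w : {set 'I_n}) :
  height_from R k w = height_from R k.+1 w + (if k \in w then hval (gap_form R k) w else 0).
Proof.
rewrite /hval /height_from; case: ifP => kw; last first.
  rewrite addr0; apply: eq_bigl => i; case: (eqVneq i k) => [->|ik]; first by rewrite kw.
  by rewrite [in RHS]ltn_neqAle eq_sym (inj_eq val_inj) ik.
rewrite (bigD1 k) /= ?kw ?leqnn // addrC; congr (_ + _).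
  apply: eq_bigl => i; rewrite -andbA; congr (_ && _).
  by rewrite ltn_neqAle [in RHS]andbC [in RHS]eq_sym (inj_eq val_inj).
by rewrite big_mkcondr; apply: eq_bigr => j _; rewrite subr0.
Qed.

(** The separation required by [unimodular_join], with [height_from_bound] as
    bound on the remaining height. *)
Lemma gap_separation (n k j d : nat) : (k < n)%N -> (d < j)%N ->
  ((n + 2) * (n.+1 * ((2 * n + 1) * (n * n * gap_base n ^ ((n - k) * n).-1)) + gap n k d)
     < gap n k j)%N.
Proof.
move=> kn dj; rewrite /gap; set B := gap_base n; set e := ((n - k) * n)%N.
have e0 : (0 < e)%N by rewrite muln_gt0; lia.
have -> : (B ^ (e + j) = B * B ^ (e + j).-1)%N by rewrite -expnS prednK // addn_gt0 e0.
have B0 : (0 < B)%N by [].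
set Q := (B ^ (e + j).-1)%N; have Q0 : (0 < Q)%N by rewrite expn_gt0 B0.
have le1 : (B ^ e.-1 <= Q)%N by apply: leq_pexp2l => //; lia.
have le2 : (B ^ (e + d) <= Q)%N by apply: leq_pexp2l => //; lia.
apply: (@leq_ltn_trans (((n + 2) * (n.+1 * ((2 * n + 1) * (n * n)) + 1)) * Q)); last first.
  by rewrite ltn_pmul2r.
rewrite -[X in (_ <= X)%N]mulnA leq_mul // [X in (_ <= X)%N]mulnDl mul1n.
by apply: leq_add le2; rewrite -!mulnA !leq_mul2l le1 !orbT.
Qed.

Lemma gap_separation0 (n k j : nat) : (k < n)%N -> (0 < j)%N ->
  ((n + 2) * (n.+1 * ((2 * n + 1) * (n * n * gap_base n ^ ((n - k) * n).-1))) < gap n k j)%N.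
Proof.
move=> kn j0; apply: leq_ltn_trans (gap_separation kn j0).
by rewrite leq_mul2l leq_addr orbT.
Qed.

(** Downward induction on [k], splitting along the element [k]; for [k = n], the
    family has at most one member. *)
Lemma unimodular_cell (R : realType) (n k : nat) (V : {set {set 'I_n}}) (f : option 'I_n -> R) (b : R) :
  (k <= n)%N -> exchange V ->
  (forall (i : 'I_n) w w', (i < k)%N -> w \in V -> w' \in V -> (i \in w) = (i \in w')) ->
  supports V (height_from R k) f b -> unimodular_family R (cell V (height_from R k) f b).
Proof.
move=> kn; move: {1}(n - k)%N (erefl (n - k)%N) => m; elim: m k kn V f b => [|m IHm] k kn V f b nk exV cV sup.
  have eqw w w' : w \in V -> w' \in V -> w = w'.
    move=> wV w'V; apply/setP=> i; apply: cV => //; have := ltn_ord i; lia.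
  move=> a aint _ w wW; move: aint; rewrite (bigD1 w) //= big1 ?addr0 // => w' /andP[w'W].
  case/negP; apply/eqP; apply: eqw; [move: w'W | move: wW];
    by rewrite finset.in_set => /andP[].
have kn' : (k < n)%N by lia.
pose k0 := Ordinal kn'.
pose sg := gap_form R (n := n) k.
have om_split w : height_from R k w = height_from R k.+1 w + (if k0 \in w then hval sg w else 0).
  exact: (height_from_split R k0).
have slice c f' : supports [set w in V | (k0 \in w) == c] (height_from R k.+1) f' b ->
    unimodular_family R (cell [set w in V | (k0 \in w) == c] (height_from R k.+1) f' b).
  apply: IHm => //; [by lia | exact: exchange_slice |].
  move=> i w w'; rewrite ltnS leq_eqVlt !finset.in_set => ik /andP[wV /eqP kw] /andP[w'V /eqP kw'].
  case/orP: ik => [/eqP ik|ik]; last exact: cV.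
  by have -> : i = k0; [apply: val_inj | rewrite kw kw'].
apply: (unimodular_join (k := k0) (om' := height_from R k.+1) (sg := sg)
   (Om := (n * n * gap_base n ^ ((n - k) * n).-1)%:R) _ _ _ erefl) => //.
- by move=> w _; apply: height_from_bound.
- by case=> [j|] //; rewrite /sg /gap_form; case: ifP.
- move=> g g' gg' sgg' moving; rewrite card_option card_ord.
  have mov i : g = Some i \/ g' = Some i -> (k < i)%N.
    move=> /moving[w [w' [[wV w'V] iww' /andP[kw kw']]]].
    rewrite ltn_neqAle leqNgt; apply/andP; split; apply: contra iww'.
      by move/eqP=> ki; have -> : i = k0; [apply: val_inj | rewrite (negPf kw) (negPf kw')].
    by move=> ik; rewrite (cV i w w').
  have B1 : (1 < gap_base n)%N by rewrite ltnS muln_gt0 !addn_gt0 !orbT.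
  move: gg' sgg'; case: g' mov {moving} => [j'|] mov; last first.
    case: g mov => // j mov _; rewrite /sg /gap_form mov; last by left.
    by rewrite lern0 expn_eq0 gtn_eqF // ltnW.
  have kj' : (k < j')%N by apply: mov; right.
  rewrite /sg /gap_form kj'; case: g mov => [j|] mov; last first.
    rewrite addr0 -!natrM ltr_nat => _ _.
    by have := gap_separation0 kn' (leq_ltn_trans (leq0n k) kj'); rewrite addn2.
  rewrite mov; last by left.
  rewrite (inj_eq Some_inj) ler_nat leq_exp2l // leq_add2l => jj' lejj'.
  rewrite -!natrM -natrD -natrM ltr_nat -addn2; apply: gap_separation => //.
  by rewrite ltn_neqAle (inj_eq val_inj) jj'.
- apply: slice => w; rewrite finset.in_set => /andP[wV /eqP kw].
  by have := sup w wV; rewrite om_split kw addr0.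
- apply: slice => w; rewrite finset.in_set => /andP[wV /eqP kw].
  by have := sup w wV; rewrite om_split kw hvalD -addrA [hval sg w + _]addrC.
Qed.

(** * Linear inequalities *)

Definition linear_form (R : realFieldType) (W : lmodType R) (f : W -> R) : Prop :=
  forall a x y, f (a *: x + y) = a * f x + f y.

Lemma linear_formZ (R : realFieldType) (W : lmodType R) (f : W -> R) a x :
  linear_form f -> f (a *: x) = a * f x.
Proof.
move=> lf; have f0 : f 0 = 0.
  have := lf 1 0 0; rewrite scale1r addr0 mul1r => f00.
  by apply: (addrI (f 0)); rewrite addr0 -f00.
by rewrite -[a *: x]addr0 lf f0 addr0.
Qed.

Lemma linear_form_sub (R : realFieldType) (W : lmodType R) (f g : W -> R) c :
  linear_form f -> linear_form g -> linear_form (fun x => f x - c * g x).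
Proof. by move=> lf lg a x y; rewrite lf lg; ring. Qed.

(** Induction on the number of forms: if the last form [A] is needed, some [x0]
    satisfies the other inequalities while [c x0 < 0] and [A x0 < 0]; the
    projection onto the kernel of [A] along [x0] removes [A]. *)
Lemma farkas_ord (R : realFieldType) (W : lmodType R) (m : nat) (A : 'I_m -> W -> R)
    (c : W -> R) :
  (forall i, linear_form (A i)) -> linear_form c ->
  (forall x, (forall i, 0 <= A i x) -> 0 <= c x) ->
  exists2 l : 'I_m -> R, forall i, 0 <= l i & forall x, c x = \sum_i l i * A i x.
Proof.
elim: m A c => [|m IHm] A c lA lc Ac.
  exists (fun=> 0) => // x; rewrite big_ord0; apply/le_anti.
  have : 0 <= c (-1 *: x) by apply: Ac; case.
  by rewrite linear_formZ // mulN1r oppr_ge0 => ->; apply: Ac; case.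
pose A' i := A (widen_ord (leqnSn m) i); pose a := A ord_max.
have [H|/existsNP[x0 /not_implyP[A'x0 /negP]]] :=
    pselect (forall x, (forall i, 0 <= A' i x) -> 0 <= c x).
  have [l l0 lE] := IHm A' c (fun i => lA _) lc H.
  exists (fun i => oapp l 0 (insub (val i))) => [i|x].
    by case: insubP => //= j _ _; apply: l0.
  rewrite big_ord_recr /= insubF ?ltnn //= mul0r addr0 lE; apply: eq_bigr => i _.
  by rewrite insubT //= => im; congr (l _ * _); apply: val_inj.
rewrite -ltNge => cx0.
have ax0 : a x0 < 0.
  rewrite ltNge; apply/negP=> ax0; move: cx0; rewrite ltNge => /negP; apply; apply: Ac => i.
  have [im|im] := ltnP i m.
    by have := A'x0 (Ordinal im); rewrite /A'; congr (0 <= A _ _); apply: val_inj.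
  have -> : i = ord_max by apply: val_inj; apply/eqP; rewrite eqn_leq im -ltnS ltn_ord.
  by [].
pose B i x := A' i x - (A' i x0 / a x0) * a x; pose d x := c x - (c x0 / a x0) * a x.
have proj f x : linear_form f -> f (- (a x / a x0) *: x0 + x) = f x - (f x0 / a x0) * a x.
  by move=> lf; rewrite lf; field; rewrite lt_eqF.
have [|||l l0 lE] := IHm B d.
- by move=> i; apply: linear_form_sub; apply: lA.
- exact: linear_form_sub (lA _).
- move=> x Bx; rewrite /d -proj //; apply: Ac => i; rewrite proj //.
  have [im|im] := ltnP i m.
    have := Bx (Ordinal im); rewrite /B /A'; congr (0 <= A _ _ - A _ _ / _ * _); exact: val_inj.
  have -> : i = ord_max by apply: val_inj; apply/eqP; rewrite eqn_leq im -ltnS ltn_ord.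
  by rewrite divff ?lt_eqF // mul1r subrr.
pose l' := (c x0 - \sum_i l i * A' i x0) / a x0.
exists (fun i => oapp l l' (insub (val i))) => [i|x].
  case: insubP => [j _ _ /=|_ /=]; first exact: l0.
  rewrite /l' -mulrNN -invrN divr_ge0 // oppr_ge0 ?(ltW ax0) //.
  rewrite subr_le0 (le_trans (ltW cx0)) // sumr_ge0 // => j _; exact: mulr_ge0.
rewrite big_ord_recr /= insubF ?ltnn //= -/a.
have -> : c x = d x + (c x0 / a x0) * a x by rewrite /d subrK.
have -> : d x = \sum_i l i * A' i x - (\sum_i l i * A' i x0) * (a x / a x0).
  by rewrite lE mulr_suml -sumrB; apply: eq_bigr => i _; rewrite /B; ring.
have -> : \sum_(i < m) oapp l l' (insub (val i)) * A (widen_ord (leqnSn m) i) x = \sum_i l i * A' i x.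
  by apply: eq_bigr => i _; rewrite insubT //= => im; congr (l _ * _); apply: val_inj.
by rewrite /l'; ring.
Qed.

(** Farkas' lemma. *)
Lemma farkas (R : realFieldType) (W : lmodType R) (I : finType) (A : I -> W -> R) (c : W -> R) :
  (forall i, linear_form (A i)) -> linear_form c ->
  (forall x, (forall i, 0 <= A i x) -> 0 <= c x) ->
  exists2 l : I -> R, forall i, 0 <= l i & forall x, c x = \sum_i l i * A i x.
Proof.
move=> lA lc Ac.
have [|x Ax|l l0 lE] := @farkas_ord R W #|I| (fun i => A (enum_val i)) c _ lc.
- by move=> i; apply: lA.
- by apply: Ac => i; rewrite -(enum_rankK i).
exists (fun i => l (enum_rank i)) => // x; rewrite lE (reindex enum_rank) /=.
  by apply: eq_bigr => i _; rewrite enum_rankK.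
by apply: onW_bij; apply: enum_rank_bij.
Qed.

Lemma linear_form_sum (R : realFieldType) (W : lmodType R) (I : finType) (P : pred I)
    (c : I -> R) (f : I -> W -> R) :
  (forall i, linear_form (f i)) -> linear_form (fun x => \sum_(i | P i) c i * f i x).
Proof.
move=> lf a x y; rewrite mulr_sumr -big_split; apply: eq_bigr => i _ /=.
by rewrite lf; ring.
Qed.

Lemma linear_form_scale (R : realFieldType) (W : lmodType R) (c : R) (f : W -> R) :
  linear_form f -> linear_form (fun x => c * f x).
Proof. by move=> lf a x y; rewrite lf; ring. Qed.

Lemma linear_formD (R : realFieldType) (W : lmodType R) (f g : W -> R) :
  linear_form f -> linear_form g -> linear_form (fun x => f x + g x).
Proof. by move=> lf lg a x y; rewrite lf lg; ring. Qed.

(** Linear programming duality with complementary slackness: if the programme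
    minimizing [\sum_I om I * w I] over [w >= 0] with [\sum_I Q j I * w I = X j]
    is feasible, and one of the equations is [\sum_I w I = 1], then it has an
    optimal solution together with a dual certificate. *)
Lemma lp_duality (R : realFieldType) (T J : finType) (V : {set T}) (Q : J -> T -> R)
    (X : J -> R) (om : T -> R) (w0 : T -> R) (j0 : J) :
  (forall I, Q j0 I = 1) -> (forall I, 0 <= w0 I) ->
  (forall j, \sum_(I in V) Q j I * w0 I = X j) ->
  exists (w : T -> R) (mu : J -> R),
    [/\ forall I, 0 <= w I, forall j, \sum_(I in V) Q j I * w I = X j,
        forall I, I \in V -> 0 <= om I + \sum_j Q j I * mu j
      & forall I, I \in V -> w I * (om I + \sum_j Q j I * mu j) = 0].
Proof.
move=> Qj0 w00 w0X; pose W := ({ffun T -> R^o} * {ffun J -> R^o} * R^o)%type.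
pose cw I (z : W) : R := z.1.1 I; pose cm j (z : W) : R := z.1.2 j; pose ct (z : W) : R := z.2.
pose ce j z := \sum_(I in V) Q j I * cw I z - X j * ct z.
pose cc I z := om I * ct z + \sum_j Q j I * cm j z.
pose cd z := - 1 * (\sum_j X j * cm j z + \sum_(I in V) om I * cw I z).
have lw I : linear_form (cw I) by move=> a x y; rewrite /cw /= !ffunE.
have lm j : linear_form (cm j) by move=> a x y; rewrite /cm /= !ffunE.
have lt : linear_form ct by move=> a x y.
have le j : linear_form (ce j) by apply: linear_form_sub => //; apply: linear_form_sum.
have lc I : linear_form (cc I).
  by apply: linear_formD; [apply: linear_form_scale | apply: linear_form_sum].
have ld : linear_form cd.
  by apply: linear_form_scale; apply: linear_formD; apply: linear_form_sum.
(* The primal and dual constraints, the inequality opposite to weak duality, and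
   the nonnegativity of the homogenizing variable. *)
pose A (i : (T + J * bool) + (T + bool)) : W -> R := match i with
  | inl (inl t) => cw t
  | inl (inr (j, s)) => fun z => (if s then 1 else -1) * ce j z
  | inr (inl t) => fun z => (if t \in V then 1 else 0) * cc t z
  | inr (inr s) => if s then cd else ct end.
have lA i : linear_form (A i).
  by case: i => [[I|[j s]]|[I|[]]] //=; apply: linear_form_scale.
have [[z [Az z0]]|nz] := pselect (exists z, (forall i, 0 <= A i z) /\ 0 < ct z).
  have zw I : 0 <= cw I z := Az (inl (inl I)).
  have ze j : \sum_(I in V) Q j I * cw I z = X j * ct z.
    have := Az (inl (inr (j, true))); have := Az (inl (inr (j, false))) => /=.
    rewrite mulN1r mul1r oppr_ge0 => h1 h2; apply/eqP; rewrite -subr_eq0.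
    by apply/eqP/le_anti; rewrite h1 h2.
  have zc I : I \in V -> 0 <= cc I z.
    by move=> VI; have := Az (inr (inl I)); rewrite /= VI mul1r.
  have zd : 0 <= cd z := Az (inr (inr true)).
  exists (fun I => cw I z / ct z), (fun j => cm j z / ct z).
  have E I : om I + \sum_j Q j I * (cm j z / ct z) = cc I z / ct z.
    rewrite /cc mulrDl mulfK ?gt_eqF // mulr_suml; congr (_ + _).
    by apply: eq_bigr => j _; rewrite mulrA.
  split=> [I|j|I VI|I VI].
  - by rewrite divr_ge0 // ltW.
  - under eq_bigr do rewrite mulrA.
    by rewrite -mulr_suml ze mulfK // gt_eqF.
  - by rewrite E divr_ge0 ?zc // ltW.
  have sum0 : \sum_(I in V) cw I z * cc I z = - (cd z * ct z).
    rewrite /cd /cc; under eq_bigr do rewrite mulrDr mulr_sumr.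
    rewrite big_split /= exchange_big /=.
    have -> : \sum_j \sum_(I in V) cw I z * (Q j I * cm j z) = ct z * \sum_j X j * cm j z.
      rewrite mulr_sumr; apply: eq_bigr => j _; rewrite mulrA [ct z * _]mulrC -ze mulr_suml.
      by apply: eq_bigr => I' _; ring.
    have -> : \sum_(I in V) cw I z * (om I * ct z) = (\sum_(I in V) om I * cw I z) * ct z.
      by rewrite mulr_suml; apply: eq_bigr => I' _; ring.
    ring.
  have : \sum_(I in V) cw I z * cc I z <= 0 by rewrite sum0 oppr_le0 mulr_ge0 // ltW.
  have nneg i : i \in V -> 0 <= cw i z * cc i z by move=> Vi; rewrite mulr_ge0 ?zc.
  move=> le0; have /eqP := @le_anti _ R _ _ (introT andP (conj le0 (sumr_ge0 _ nneg))).
  rewrite psumr_eq0 // => /allP /(_ I); rewrite mem_index_enum VI => /(_ isT) /eqP => cwc.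
  by rewrite E mulrACA cwc mul0r.
(* The form [- ct] is nonnegative on the constraints, hence a nonnegative combination
   of them; evaluating this identity at suitable points gives a contradiction. *)
exfalso; have [||l l0 lE] := farkas (c := fun z => - 1 * ct z) lA.
- exact: linear_form_scale.
- move=> z Az; rewrite mulN1r oppr_ge0 leNgt; apply/negP => z0; apply: nz; by exists z.
pose la I := l (inl (inl I)); pose ga j := l (inl (inr (j, true))) - l (inl (inr (j, false))).
pose lc' I := l (inr (inl I)); pose ld' := l (inr (inr true)); pose le' := l (inr (inr false)).
have {}lE z : - ct z = \sum_I la I * cw I z + \sum_j ga j * ce j z +
    (\sum_(I in V) lc' I * cc I z + (ld' * cd z + le' * ct z)).
  rewrite -mulN1r lE !big_sumType /= big_bool; congr (_ + _ + (_ + _)).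
    transitivity (\sum_j \sum_(s : bool) l (inl (inr (j, s))) * ((if s then 1 else -1) * ce j z)).
      by rewrite pair_bigA; apply: eq_bigr => -[j s] _.
    by apply: eq_bigr => j _; rewrite big_bool /= /ga; ring.
  rewrite [RHS]big_mkcond; apply: eq_bigr => I _; rewrite /lc'.
  by case: ifP; rewrite ?mul1r ?mul0r ?mulr0.
have {}lE (w : {ffun T -> R^o}) (m : {ffun J -> R^o}) (t : R) :
    - t = \sum_I la I * w I + \sum_j ga j * (\sum_(I in V) Q j I * w I - X j * t) +
    (\sum_(I in V) lc' I * (om I * t + \sum_j Q j I * m j) +
     (ld' * (- 1 * (\sum_j X j * m j + \sum_(I in V) om I * w I)) + le' * t)) :=
  lE (w, m, t).
have ld0 : 0 <= ld' by apply: l0.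
have le0 : 0 <= le' by apply: l0.
have S0 (K : finType) (P : pred K) (c : K -> R) :
    \sum_(i | P i) c i * (0 : {ffun K -> R^o}) i = 0.
  by rewrite big1 // => i _; rewrite ffunE mulr0.
have Et : \sum_j ga j * X j = 1 + le' + \sum_(I in V) lc' I * om I.
  have := lE 0 0 1; rewrite !S0.
  under eq_bigr do rewrite S0 sub0r mulr1 mulrN.
  under [X in _ = _ + (X + _)]eq_bigr do rewrite S0 addr0 mulr1.
  by rewrite sumrN; lra.
have Em j : \sum_(I in V) lc' I * Q j I = ld' * X j.
  have D (P : pred J) (c : J -> R) :
      P j -> \sum_(i | P i) c i * ([ffun i' => (i' == j)%:R] : {ffun J -> R^o}) i = c j.
    move=> Pj; rewrite (bigD1 j) //= ffunE eqxx mulr1 big1 ?addr0 // => i /andP[_ /negPf ij].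
    by rewrite ffunE ij mulr0.
  have := lE 0 [ffun i => (i == j)%:R] 0; rewrite !S0.
  under eq_bigr do rewrite S0 mulr0 subrr mulr0.
  under [X in _ = _ + (X + _)]eq_bigr do rewrite mulr0 add0r D //.
  by rewrite D // big1 //; lra.
(* The multipliers [lc'] of the dual constraints are taken as primal solution. *)
have ld00 : ld' = 0.
  have := lE [ffun I => lc' I] 0 0; rewrite !S0.
  under eq_bigr do rewrite ffunE.
  under [X in _ = _ + X + _]eq_bigr => j _.
    under eq_bigr do rewrite ffunE mulrC.
    rewrite Em mulr0 subr0 mulrCA; over.
  under [X in _ = _ + (X + _)]eq_bigr do rewrite S0 mulr0 addr0 mulr0.
  under [X in _ = _ + (_ + (_ * (_ * (_ + X)) + _))]eq_bigr do rewrite ffunE mulrC.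
  rewrite -mulr_sumr Et [X in _ + (X + _)]big1 //.
  have : 0 <= \sum_I la I * lc' I by apply: sumr_ge0 => I _; rewrite mulr_ge0 ?l0.
  have := mulr_ge0 ld0 le0.
  set x1 := \sum_I la I * lc' I; set x2 := \sum_(I in V) _ => h1 h2 h3.
  apply/le_anti/andP; split=> //; nra.
have lc0 I : I \in V -> lc' I = 0.
  have /eqP := Em j0; rewrite ld00 mul0r psumr_eq0 => [/allP /(_ I)|i _]; last first.
    by rewrite Qj0 mulr1 l0.
  by rewrite mem_index_enum Qj0 mulr1 => /(_ isT) /implyP /[apply] /eqP.
have := lE [ffun I => w0 I] 0 0; rewrite !S0 ld00.
under eq_bigr do rewrite ffunE.
under [X in _ = _ + X + _]eq_bigr => j _.
  under eq_bigr do rewrite ffunE.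
  rewrite w0X mulr0 subr0; over.
have -> : \sum_j ga j * X j = 1 + le'.
  by rewrite Et [X in _ + X]big1 ?addr0 // => I VI; rewrite lc0 // mul0r.
rewrite [X in _ + (X + _)]big1 => [|I VI]; last by rewrite lc0 // mul0r.
have : 0 <= \sum_I la I * w0 I by apply: sumr_ge0 => I _; rewrite mulr_ge0 ?l0.
lra.
Qed.

(** * Regular subdivisions of the convex hull of finitely many points *)

(** The convex hull of the points [q I], for [I] in [V]. *)
Definition hull (R : realType) (n : nat) (T : finType) (q : T -> 'rV[R]_n) (V : {set T}) :
    set 'rV[R]_n :=
  conv [set x | exists2 I, I \in V & x = q I]%classic.

Lemma hullP (R : realType) (n : nat) (T : finType) (q : T -> 'rV[R]_n) (V : {set T}) x :
  hull q V x <-> exists w : T -> R,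
    [/\ forall I, 0 <= w I, \sum_(I in V) w I = 1 & x = \sum_(I in V) w I *: q I].
Proof.
split=> [[k [p [w [pV w0 w1 xE]]]]|[w [w0 w1 xE]]]; last first.
  exists #|V|, (fun i => q (enum_val i)), (fun i => w (enum_val i)); split=> //.
  - by move=> i; exists (enum_val i) => //; apply: enum_valP.
  - by rewrite -w1 [RHS]big_enum_val.
  - by rewrite xE big_enum_val.
have [|phi phiP] := @boolp.choice _ _ (fun i I => I \in V /\ p i = q I).
  by move=> i; have [I VI pI] := pV i; exists I.
exists (fun I => \sum_(i | phi i == I) w i); split.
- by move=> I; apply: sumr_ge0.
- by rewrite -w1 (partition_big phi (mem V)) //= => i _; case: (phiP i).
rewrite xE (partition_big phi (mem V)) //= => [|i _]; last by case: (phiP i).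
by apply: eq_bigr => I _; rewrite scaler_suml; apply: eq_bigr => i /eqP <-; case: (phiP i) => _ ->.
Qed.

Lemma dotpDl (R : realType) (n : nat) (c d x : 'rV[R]_n) : dotp (c + d) x = dotp c x + dotp d x.
Proof. by rewrite /dotp -big_split; apply: eq_bigr => i _; rewrite mxE mulrDl. Qed.

Lemma dotpZl (R : realType) (n : nat) a (c x : 'rV[R]_n) : dotp (a *: c) x = a * dotp c x.
Proof. by rewrite /dotp mulr_sumr; apply: eq_bigr => i _; rewrite mxE mulrA. Qed.

Lemma dotpBl (R : realType) (n : nat) (c d x : 'rV[R]_n) : dotp (c - d) x = dotp c x - dotp d x.
Proof. by rewrite dotpDl -scaleN1r dotpZl mulN1r. Qed.

Lemma dotp_sumr (R : realType) (n : nat) (T : finType) (P : pred T) (w : T -> R)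
    (q : T -> 'rV[R]_n) (c : 'rV[R]_n) :
  dotp c (\sum_(I | P I) w I *: q I) = \sum_(I | P I) w I * dotp c (q I).
Proof.
rewrite /dotp; under [RHS]eq_bigr do rewrite mulr_sumr.
rewrite exchange_big; apply: eq_bigr => i _; rewrite summxE mulr_sumr.
by apply: eq_bigr => I _; rewrite mxE; ring.
Qed.

Lemma sum_option (V : nmodType) (T : finType) (F : option T -> V) :
  \sum_j F j = F None + \sum_i F (Some i).
Proof.
rewrite (bigD1 None) //= (reindex_omap Some id) => [|[]] //; congr (_ + _).
by apply: eq_bigl => i; rewrite eqxx.
Qed.

Lemma sum_support (V : nmodType) (T : finType) (A B : {set T}) (F : T -> V) :
  B \subset A -> (forall I, I \in A -> I \notin B -> F I = 0) ->
  \sum_(I in A) F I = \sum_(I in B) F I.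
Proof.
move=> sBA F0; rewrite (big_setID B) /= (finset.setIidPr sBA) [X in _ + X]big1 ?addr0 // => I.
by rewrite finset.in_setD => /andP[IB IA]; apply: F0.
Qed.

Lemma hullS (R : realType) (n : nat) (T : finType) (q : T -> 'rV[R]_n) (A B : {set T}) x :
  B \subset A -> hull q B x -> hull q A x.
Proof.
move=> sBA [k [p [w [pB w0 w1 xE]]]]; exists k, p, w; split=> // i.
by have [I BI pI] := pB i; exists I => //; apply: (fintype.subsetP sBA).
Qed.

Lemma hull_in (R : realType) (n : nat) (T : finType) (q : T -> 'rV[R]_n) (V : {set T}) I :
  I \in V -> hull q V (q I).
Proof.
move=> VI; apply/hullP; exists (fun J => (J == I)%:R); split; first by move=> J; case: eqP.
  by rewrite (bigD1 I) //= eqxx big1 ?addr0 // => J /andP[_ /negPf ->].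
by rewrite (bigD1 I) //= eqxx scale1r big1 ?addr0 // => J /andP[_ /negPf ->]; rewrite scale0r.
Qed.

Lemma hull_ge (R : realType) (n : nat) (T : finType) (q : T -> 'rV[R]_n) (V : {set T}) c b x :
  (forall I, I \in V -> b <= dotp c (q I)) -> hull q V x -> b <= dotp c x.
Proof.
move=> cb /hullP[w [w0 w1 ->]]; rewrite dotp_sumr -[b]mul1r -w1 mulr_suml.
by apply: ler_sum => I VI; rewrite ler_wpM2l // cb.
Qed.

Lemma hull_face (R : realType) (n : nat) (T : finType) (q : T -> 'rV[R]_n) (V : {set T}) c b :
  (forall I, I \in V -> b <= dotp c (q I)) ->
  (hull q V `&` [set x | dotp c x = b] = hull q (finset (fun I => (I \in V) && (dotp c (q I) == b))))%classic.
Proof.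
move=> cb; apply/seteqP; split=> x; last first.
  move=> hx; split; first by apply: hullS hx; apply/fintype.subsetP=> I /[!finset.in_set] /andP[].
  move: hx => /hullP[w [w0 w1 ->]] /=; rewrite dotp_sumr -[RHS]mul1r -w1 mulr_suml.
  by apply: eq_bigr => I /[!finset.in_set] /andP[_ /eqP ->].
move=> [/hullP[w [w0 w1 ->]] /=]; rewrite dotp_sumr => xb.
have /eqP : \sum_(I in V) w I * (dotp c (q I) - b) = 0.
  by under eq_bigr do rewrite mulrBr; rewrite sumrB xb -mulr_suml w1 mul1r subrr.
rewrite psumr_eq0 => [/allP wt|I VI]; last by rewrite mulr_ge0 // subr_ge0 cb.
have wz I : I \in V -> I \notin finset (fun I => (I \in V) && (dotp c (q I) == b)) -> w I = 0.
  move=> VI; have := wt I; rewrite mem_index_enum VI => /(_ isT).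
  by rewrite finset.in_set VI mulf_eq0 subr_eq0 => /orP[/eqP|->].
have sub : finset (fun I => (I \in V) && (dotp c (q I) == b)) \subset V.
  by apply/fintype.subsetP=> I /[!finset.in_set] /andP[].
apply/hullP; exists w; split=> //; first by rewrite -(sum_support sub).
by rewrite (sum_support sub) // => I VI nI; rewrite wz // scale0r.
Qed.

(** [b] is a lower bound, at the points [q I] with heights [om I], for the linear
    form with coefficients [c] on the points and [1] on the height. *)
Definition valid_form (R : realType) (n : nat) (T : finType) (q : T -> 'rV[R]_n)
    (om : T -> R) (V : {set T}) (c : 'rV[R]_n) (b : R) : Prop :=
  forall I, I \in V -> b <= om I + dotp c (q I).

(** The points at which such a lower bound is attained. *)
Definition tight (R : realType) (n : nat) (T : finType) (q : T -> 'rV[R]_n)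
    (om : T -> R) (V : {set T}) (c : 'rV[R]_n) (b : R) : {set T} :=
  [set I in V | om I + dotp c (q I) == b].

(** The projections of the lower faces of the convex hull of the points
    [(q I, om I)]; linear forms are normalized to have last coefficient [1]. *)
Definition regular_cells (R : realType) (n : nat) (T : finType) (q : T -> 'rV[R]_n)
    (om : T -> R) (V : {set T}) : set (set 'rV[R]_n) :=
  [set Q | exists c b, valid_form q om V c b /\ Q = hull q (tight q om V c b)]%classic.

Lemma small_multiple (R : realType) (T : finType) (g h : T -> R) (P : pred T) :
  (forall I, P I -> 0 < g I) -> exists2 e, 0 < e & forall I, P I -> 0 < g I + e * h I.
Proof.
move=> g0; pose s := 1 + \sum_(I | P I) `|h I| / g I.
have s0 : 0 < s by rewrite ltr_pwDl // sumr_ge0 // => I PI; rewrite divr_ge0 // ltW // g0.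
exists s^-1 => [|I PI]; first by rewrite invr_gt0.
rewrite -(pmulr_rgt0 _ s0) mulrDr mulrA divff ?gt_eqF // mul1r.
have h1 : g I + `|h I| <= s * g I.
  rewrite /s (bigD1 I) //= addrA mulrDl mulrDl mul1r divfK ?gt_eqF ?g0 // lerDl.
  apply: mulr_ge0; last exact: ltW (g0 I PI).
  by apply: sumr_ge0 => J /andP[PJ _]; rewrite divr_ge0 // ltW // g0.
have := g0 I PI; have : - h I <= `|h I| by rewrite -normrN ler_norm.
lra.
Qed.

Lemma hull_polytope (R : realType) (n : nat) (T : finType) (q : T -> 'rV[R]_n) (V : {set T}) :
  polytope (hull q V).
Proof.
exists [set x | exists2 I, I \in V & x = q I]%classic => //.
apply: (@sub_finite_set _ _ (q @` [set: T])%classic) => [x [I _ ->]|]; first by exists I.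
exact/finite_image/finite_finset.
Qed.

(** Points of the convex hull lie on the lower hull above them: linear
    programming duality, the equations being those that fix the coordinates of
    the point and the total weight. *)
Lemma regular_cells_cover (R : realType) (n : nat) (T : finType) (q : T -> 'rV[R]_n)
    (om : T -> R) (V : {set T}) x :
  hull q V x -> exists2 Q, regular_cells q om V Q & Q x.
Proof.
move=> /hullP[w0 [w00 w01 xE]].
pose Q (j : option 'I_n) I : R := if j is Some i then q I 0 i else 1.
pose X (j : option 'I_n) : R := if j is Some i then x 0 i else 1.
have w0X j : \sum_(I in V) Q j I * w0 I = X j.
  case: j => [i|] /=; last by under eq_bigr do rewrite mul1r.
  by rewrite xE summxE; apply: eq_bigr => I _; rewrite mxE mulrC.
have [w [mu [wge wX dual slack]]] := lp_duality om (j0 := None) (fun I => erefl) w00 w0X.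
pose c : 'rV[R]_n := \row_i mu (Some i).
have muE I : om I + \sum_j Q j I * mu j = om I + dotp c (q I) + mu None.
  rewrite sum_option /= mul1r addrA addrAC; congr (_ + _ + _).
  by apply: eq_bigr => i _; rewrite mxE mulrC.
have w1 : \sum_(I in V) w I = 1 by have := wX None; under eq_bigr do rewrite mul1r.
exists (hull q (tight q om V c (- mu None))).
  by exists c, (- mu None); split=> // I VI; rewrite -subr_ge0 opprK -muE dual.
have wz I : I \in V -> I \notin tight q om V c (- mu None) -> w I = 0.
  move=> VI; rewrite finset.in_set VI /= -subr_eq0 opprK -muE => nz.
  by have /eqP := slack I VI; rewrite mulf_eq0 (negPf nz) orbF => /eqP.
have sub : tight q om V c (- mu None) \subset V.
  by apply/fintype.subsetP=> I /[!finset.in_set] /andP[].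
apply/hullP; exists w; split=> //; first by rewrite -(sum_support sub).
rewrite -(sum_support sub) => [|I VI nI]; last by rewrite wz // scale0r.
apply/rowP=> i; have := wX (Some i); rewrite summxE /= => <-.
by apply: eq_bigr => I _; rewrite mxE mulrC.
Qed.

(** A face of a cell is cut out by adding to the form that defines the cell a
    small multiple of the form that defines the face. *)
Lemma regular_cells_face (R : realType) (n : nat) (T : finType) (q : T -> 'rV[R]_n)
    (om : T -> R) (V : {set T}) Q F :
  regular_cells q om V Q -> face Q F -> regular_cells q om V F.
Proof.
move=> [c [b [val ->]]] [d [e [dQ ->]]].
have de I : I \in tight q om V c b -> e <= dotp d (q I) by move=> /(hull_in q) /dQ.
have [|eps eps0 H] := @small_multiple R T (fun I => om I + dotp c (q I) - b)
  (fun I => dotp d (q I) - e) (fun I => (I \in V) && (I \notin tight q om V c b)).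
  move=> I /andP[VI]; rewrite finset.in_set VI /= => neq.
  by rewrite subr_gt0 lt_neqAle eq_sym neq val.
have eqI I : om I + dotp (c + eps *: d) (q I) - (b + eps * e) =
    om I + dotp c (q I) - b + eps * (dotp d (q I) - e).
  by rewrite dotpDl dotpZl; ring.
rewrite hull_face //; exists (c + eps *: d), (b + eps * e); split.
  move=> I VI; rewrite -subr_ge0 eqI; have [tI|tI] := boolP (I \in tight q om V c b).
    by rewrite addr_ge0 ?subr_ge0 ?val // mulr_ge0 ?subr_ge0 ?de // ltW.
  by apply/ltW/H; rewrite VI.
congr (hull q _); apply/setP=> I; rewrite finset.in_set [in RHS]finset.in_set.
have [VI|VI] /= := boolP (I \in V); last by rewrite finset.in_set (negPf VI).
rewrite -[in RHS]subr_eq0 eqI; have [tI|tI] /= := boolP (I \in tight q om V c b).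
  move: tI; rewrite finset.in_set VI => /eqP ->.
  by rewrite subrr add0r mulf_eq0 (gt_eqF eps0) /= subr_eq0.
by rewrite gt_eqF // H // VI.
Qed.

(** The difference of the two forms that define the cells cuts out their
    intersection. *)
Lemma regular_cells_meet (R : realType) (n : nat) (T : finType) (q : T -> 'rV[R]_n)
    (om : T -> R) (V : {set T}) Q1 Q2 :
  regular_cells q om V Q1 -> regular_cells q om V Q2 -> face Q1 (Q1 `&` Q2)%classic.
Proof.
move=> [c [b [cV ->]]] [d [e [dV ->]]].
have cd I : I \in tight q om V c b -> e - b <= dotp (d - c) (q I).
  by rewrite finset.in_set => /andP[/dV + /eqP <-]; rewrite dotpBl; lra.
have dc I : I \in tight q om V d e -> b - e <= dotp (c - d) (q I).
  by rewrite finset.in_set => /andP[/cV + /eqP <-]; rewrite dotpBl; lra.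
exists (d - c), (e - b); split; first by move=> x; apply: hull_ge.
apply/seteqP; split=> x [x1 x2]; split=> //.
  move: (hull_ge cd x1) (hull_ge dc x2) => /=; rewrite !dotpBl; lra.
have : (hull q (tight q om V c b) `&` [set y | dotp (d - c) y = e - b])%classic x by split.
rewrite hull_face //; apply: hullS; apply/fintype.subsetP=> I.
rewrite !finset.in_set => /andP[/andP[-> /eqP h1]] /eqP; rewrite dotpBl => h2.
by apply/eqP; move: h1 h2; lra.
Qed.

Lemma regular_cells_subdivision (R : realType) (n : nat) (T : finType) (q : T -> 'rV[R]_n)
    (om : T -> R) (V : {set T}) :
  subdivision (hull q V) (regular_cells q om V).
Proof.
split.
- apply: (@sub_finite_set _ _ (hull q @` [set: {set T}])%classic) => [Q [c [b [_ ->]]]|].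
    by exists (tight q om V c b).
  exact/finite_image/finite_finset.
- by move=> Q [c [b [_ ->]]]; apply: hull_polytope.
- apply/seteqP; split=> [x [Q [c [b [_ ->]]]]|x /(regular_cells_cover om) [Q]].
    by apply: hullS; apply/fintype.subsetP=> I /[!finset.in_set] /andP[].
  by exists Q.
- exact: regular_cells_face.
- move=> Q1 Q2 S1 S2; split; first exact: regular_cells_meet S1 S2.
  by rewrite classical_sets.setIC; apply: regular_cells_meet S2 S1.
Qed.

Lemma vertex_hull (R : realType) (n : nat) (T : finType) (q : T -> 'rV[R]_n) (V : {set T}) x :
  vertex (hull q V) x -> exists2 I, I \in V & x = q I.
Proof.
move=> [c [b [cb xE]]].
have cV I : I \in V -> b <= dotp c (q I) by move=> /(hull_in q) /cb.
rewrite hull_face // in xE.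
have /hullP[w [w0 w1 _]] : hull q (finset (fun I => (I \in V) && (dotp c (q I) == b))) x.
  by rewrite -xE.
have [I] : exists I, I \in finset (fun I => (I \in V) && (dotp c (q I) == b)).
  apply/finset.set0Pn/eqP => V0; move: w1; rewrite V0 big_set0 => /eqP.
  by rewrite eq_sym oner_eq0.
move=> IV'; exists I; first by move: IV'; rewrite finset.in_set => /andP[].
have : [set x]%classic (q I) by rewrite xE; apply: hull_in.
by move=> /= ->.
Qed.

Lemma dotp_row_mx (R : realType) (n : nat) (d x : 'rV[R]_n) (h y : R) :
  dotp (row_mx d h%:M) (row_mx x y%:M) = dotp d x + h * y.
Proof.
rewrite /dotp big_split_ord /=; congr (_ + _).
  by apply: eq_bigr => i _; rewrite !row_mxEl.
by rewrite big_ord1 !row_mxEr !mxE eqxx !mulr1n.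
Qed.

Lemma lsubmx_hull (R : realType) (n : nat) (T : finType) (q : T -> 'rV[R]_n) (y : T -> 'rV[R]_1)
    (V : {set T}) :
  (lsubmx @` hull (fun I => row_mx (q I) (y I)) V)%classic = hull q V.
Proof.
have E (w : T -> R) : lsubmx (\sum_(I in V) w I *: row_mx (q I) (y I)) = \sum_(I in V) w I *: q I.
  by rewrite linear_sum; apply: eq_bigr => I _; rewrite linearZ /= row_mxKl.
apply/seteqP; split=> x.
  by move=> [_ /hullP[w [w0 w1 ->]] <-]; rewrite E; apply/hullP; exists w.
move=> /hullP[w [w0 w1 ->]]; rewrite -E.
by exists (\sum_(I in V) w I *: row_mx (q I) (y I)) => //; apply/hullP; exists w.
Qed.

Lemma induced_subdivisionE (R : realType) (n : nat) (T : finType) (q : T -> 'rV[R]_n)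
    (V : {set T}) (f : 'rV[R]_n -> R) :
  induced_subdivision [set x | exists2 I, I \in V & x = q I]%classic f =
  regular_cells q (f \o q) V.
Proof.
pose p I := row_mx (q I) (f (q I))%:M.
have liftE : (lift_point f @` [set x | exists2 I, I \in V & x = q I] =
    [set x | exists2 I, I \in V & x = p I])%classic.
  apply/seteqP; split=> x; first by move=> [_ [I VI ->] <-]; exists I.
  by move=> [I VI ->]; exists (q I) => //; exists I.
have tightE d h b : 0 < h ->
    finset (fun I => (I \in V) && (dotp (row_mx d h%:M) (p I) == b)) =
    tight q (f \o q) V (h^-1 *: d) (b / h).
  move=> h0; apply/setP=> I; rewrite !finset.in_set; congr (_ && _).
  rewrite dotp_row_mx dotpZl /=; apply/eqP/eqP => [<-|e]; first by field; rewrite gt_eqF.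
  have -> : b = h * (b / h) by rewrite mulrC divfK // gt_eqF.
  by rewrite -e; field; rewrite gt_eqF.
rewrite /induced_subdivision liftE; apply/seteqP; split=> Q.
  move=> [_ [d [h [b [h0 [dQ ->]]]]] <-].
  have dV I : I \in V -> b <= dotp (row_mx d h%:M) (p I) by move=> /(hull_in p) /dQ.
  exists (h^-1 *: d), (b / h); split; last by rewrite -/(hull p V) hull_face // tightE // lsubmx_hull.
  move=> I /dV; rewrite dotp_row_mx dotpZl /= ler_pdivrMr //; congr (_ <= _).
  by field; rewrite gt_eqF.
move=> [d [b [val ->]]]; have dV I : I \in V -> b <= dotp (row_mx d 1%:M) (p I).
  by move=> /val; rewrite dotp_row_mx mul1r addrC.
exists (hull p (finset (fun I => (I \in V) && (dotp (row_mx d 1%:M) (p I) == b)))); last first.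
  by rewrite lsubmx_hull tightE // invr1 scale1r mulr1.
exists d, 1, b; split=> //; split; last by rewrite -hull_face.
by move=> x; apply: hull_ge.
Qed.

(** * Unimodular simplices *)

(** The vertices [v i] are integral, and the vectors [(1, v i)] form a basis of
    the lattice of integral points of their linear span. *)
Definition unimodular_points (R : realType) (n k : nat) (v : 'I_k -> 'rV[R]_n) : Prop :=
  (forall i, integral_points (v i)) /\
  forall a : 'I_k -> R, \sum_i a i \is a Num.int ->
    integral_points (\sum_i a i *: v i) -> forall i, a i \is a Num.int.

Lemma unimodular_points_free (R : realType) (n k : nat) (v : 'I_k -> 'rV[R]_n) :
  unimodular_points v -> affinely_independent v.
Proof.
move=> [_ uv] a a0 av0 i; apply: contrapT => /eqP ai.
(* A multiple of [a] with the value [1/2] at [i] is again a relation. *)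
have /(_ _ _ i) := uv (fun j => (2 * a i)^-1 * a j).
rewrite -mulr_sumr a0 mulr0 rpred0.
have -> : \sum_j ((2 * a i)^-1 * a j) *: v j = 0.
  by under eq_bigr do rewrite -scalerA; rewrite -scaler_sumr av0 scaler0.
have -> : (2 * a i)^-1 * a i = 2^-1 by field.
move=> /(_ isT) H; have /intrP[m] : (2^-1 : R) \is a Num.int.
  by apply: H => j; rewrite mxE rpred0.
move=> h; have : (2 * m)%:~R = 1%:~R :> R by rewrite intrM -h mulfV // pnatr_eq0.
by move/eqP; rewrite eqr_int; lia.
Qed.

(** Directions of a convex hull are combinations of the points with total weight
    zero. *)
Lemma lin_conv (R : realType) (n k : nat) (v : 'I_k -> 'rV[R]_n) x :
  lin (conv (range v)) x -> exists2 a : 'I_k -> R, \sum_i a i = 0 & x = \sum_i a i *: v i.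
Proof.
have hullE : conv (range v) = hull v [set: 'I_k].
  by congr conv; apply/seteqP; split=> y [i _ e]; exists i.
move=> [m [p [q [a [pT qT ->]]]]].
have wts (r : 'I_m -> 'rV[R]_n) : (forall l, conv (range v) (r l)) ->
    exists w : 'I_m -> 'I_k -> R, forall l, \sum_i w l i = 1 /\ r l = \sum_i w l i *: v i.
  move=> rT; have [|w wP] := @boolp.choice _ _
    (fun l (w : 'I_k -> R) => \sum_i w i = 1 /\ r l = \sum_i w i *: v i); last by exists w.
  move=> l; have := rT l; rewrite hullE => /hullP[w [_ w1 rE]]; exists w.
  have sumT (U : nmodType) (F : 'I_k -> U) : \sum_(i in [set: 'I_k]) F i = \sum_i F i.
    by apply: eq_bigl => i; rewrite finset.in_setT.
  by move: w1 rE; rewrite !sumT.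
have [wp wpE] := wts p pT; have [wq wqE] := wts q qT.
exists (fun i => \sum_l a l * (wp l i - wq l i)).
  rewrite exchange_big big1 //= => l _; rewrite -mulr_sumr sumrB.
  by case: (wpE l) => -> _; case: (wqE l) => -> _; rewrite subrr mulr0.
under [RHS]eq_bigr do rewrite scaler_suml; rewrite exchange_big; apply: eq_bigr => l _ /=.
case: (wpE l) => _ {1}->; case: (wqE l) => _ {1}->; rewrite -sumrB scaler_sumr.
by apply: eq_bigr => i _; rewrite -scalerBl scalerA.
Qed.

Lemma free_mkseq (R : realType) (n k : nat) (v : 'I_k.+1 -> 'rV[R]_n) :
  affinely_independent v -> free (mkseq (fun i => v (inord i.+1) - v ord0) k).
Proof.
move=> av; have sB : size (mkseq (fun i => v (inord i.+1) - v ord0) k) == k by rewrite size_mkseq.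
change (free (Tuple sB)); apply/freeP => c /=.
under eq_bigr => i _ do rewrite nth_mkseq //.
move=> c0.
pose a (i : 'I_k.+1) := if unlift ord0 i is Some j then c j else - \sum_j c j.
have a0 : a ord0 = - \sum_j c j by rewrite /a unlift_none.
have aS j : a (lift ord0 j) = c j by rewrite /a liftK.
have inordS (i : 'I_k) : inord i.+1 = lift ord0 i :> 'I_k.+1.
  by apply: val_inj; rewrite /= inordK // ltnS.
move=> i; rewrite -aS; apply: av.
  by rewrite big_ord_recl a0 [X in _ + X](eq_bigr c) ?addNr.
rewrite big_ord_recl a0 -[RHS]c0 scaleNr scaler_suml addrC -sumrB; apply: eq_bigr => j _.
by rewrite aS inordS scalerBr.
Qed.

Lemma unimodular_points_simplex (R : realType) (n k : nat) (v : 'I_k -> 'rV[R]_n) :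
  unimodular_points v -> unimodular_simplex (conv (range v)).
Proof.
move=> uv; have av := unimodular_points_free uv; have [vint vu] := uv.
exists k, v; split=> //.
case: k v uv av vint vu => [|k] v uv av vint vu.
  exists [::]; split; first by split=> //; [apply: nil_free | move=> e [[]]].
  split; first exact: nil_free.
  apply/seteqP; split=> x.
    by move=> [/lin_conv[a _ ->] _]; exists [ffun=> 0]; rewrite !big_ord0.
  move=> [a ->]; rewrite big_ord0; split; last by move=> i; rewrite mxE rpred0.
  by exists 0%N, (fun=> 0), (fun=> 0), (fun=> 0); split; [case|case|rewrite big_ord0].
pose B := mkseq (fun i => v (inord i.+1) - v ord0) k.
have sB : size B = k by rewrite size_mkseq.
have fB : free B by apply: free_mkseq.
have nB i : (i < k)%N -> B`_i = v (inord i.+1) - v ord0 by move=> ik; rewrite nth_mkseq.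
have inordS (i : 'I_k) : inord i.+1 = lift ord0 i :> 'I_k.+1.
  by apply: val_inj; rewrite /= inordK // ltnS.
exists B; split; split=> //.
- by move=> e /mapP[i _ ->]; exists (inord i.+1), ord0.
- move=> e [i [j ->]]; rewrite free_cons fB andbT negbK.
  have vB l : v l - v ord0 \in <<B>>%VS.
    case: (unliftP ord0 l) => [l' ->|->]; last by rewrite subrr mem0v.
    apply: memv_span; apply/mapP; exists (val l'); first by rewrite mem_iota /=.
    by rewrite inordS.
  by rewrite -(subrKA (v ord0)) addrC -[v ord0 - v j]opprB addrC memvB.
apply/seteqP; split=> x.
  move=> [/lin_conv[a a0 xE] xint].
  have aint : forall i, a i \is a Num.int by apply: vu; rewrite -?xE // a0 rpred0.
  exists [ffun i : 'I_(size B) => Num.floor (a (inord i.+1))].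
  rewrite (eq_bigr (fun i : 'I_(size B) => a (inord i.+1) *: (v (inord i.+1) - v ord0))); last first.
    move=> i _; rewrite ffunE nB -?sB // -scaler_int; congr (_ *: _).
    by rewrite floorK ?aint.
  rewrite -(big_mkord xpredT (fun i => a (inord i.+1) *: (v (inord i.+1) - v ord0))) sB big_mkord.
  rewrite xE big_ord_recl; move: a0; rewrite big_ord_recl => /eqP; rewrite addr_eq0 => /eqP ->.
  rewrite scaleNr scaler_suml addrC -sumrB; apply: eq_bigr => i _.
  by rewrite inordS scalerBr.
move=> [c ->]; split.
  exists (size B), (fun i => v (inord i.+1)), (fun=> v ord0), (fun i => (c i)%:~R).
  have vT l : conv (range v) (v l).
    exists 1%N, (fun=> v l), (fun=> 1); split=> //; first by rewrite big_ord1.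
    by rewrite big_ord1 scale1r.
  by split=> //; apply: eq_bigr => i _; rewrite nB -?sB // scaler_int.
move=> j; rewrite summxE; apply: rpred_sum => i _; rewrite nB -?sB // -scaler_int mxE.
by rewrite rpredM ?intr_int // !mxE rpredB // vint.
Qed.

(** Coefficient families indexed by ['I_#|W|] and by the members of [W]
    correspond through the enumeration of [W]. *)
Lemma unimodular_simplex_hull (R : realType) (n : nat) (W : {set {set 'I_n}}) :
  unimodular_family R W -> unimodular_simplex (hull (chi R) W).
Proof.
move=> uW; pose v (i : 'I_#|W|) : 'rV[R]_n := chi R (enum_val i).
have -> : hull (chi R) W = conv (range v).
  congr conv; apply/seteqP; split=> x; last by move=> [i _ <-]; exists (enum_val i) => //; apply: enum_valP.
  by move=> [I WI ->]; exists (enum_rank_in WI I) => //; rewrite /v enum_rankK_in.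
apply: unimodular_points_simplex; split=> [i j|a aint xint i].
  by rewrite mxE; case: (j \in enum_val i); rewrite ?rpred0 ?rpred1.
pose al (I : {set 'I_n}) := \sum_(i | enum_val i == I :> {set 'I_n}) a i.
have alE (l : 'I_#|W|) : al (enum_val l) = a l.
  by rewrite /al (big_pred1 l) // => l'; rewrite (inj_eq enum_val_inj).
rewrite -alE; apply: uW; last exact: enum_valP.
  by rewrite big_enum_val; under eq_bigr do rewrite alE.
move=> j; rewrite big_mkcondr big_enum_val.
rewrite (eq_bigr (fun l => (a l *: v l) 0 j)) -?summxE // => l _; rewrite alE !mxE.
by case: (j \in enum_val l); rewrite ?mulr1 ?mulr0.
Qed.

(** * The triangulation *)

(** The quadratic form whose values at the indicator vectors are the heights. *)
Definition height (R : realType) (n : nat) (x : 'rV[R]_n) : R :=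
  \sum_(i < n) \sum_(j < n | (i < j)%N) (gap n i j)%:R * (x 0 i * x 0 j).

Lemma height_chi (R : realType) (n : nat) (w : {set 'I_n}) : height (chi R w) = height_from R 0 w.
Proof.
rewrite /height_from [RHS]big_mkcond; apply: eq_bigr => i _.
rewrite andbT; case: ifP => iw; last first.
  by rewrite big1 // => j _; rewrite !mxE iw mul0r mulr0.
rewrite [RHS]big_mkcondl; apply: eq_bigr => j _; rewrite !mxE iw mul1r.
by case: (j \in w); rewrite ?mulr1 ?mulr0.
Qed.

Lemma hval_chi (R : realType) (n : nat) (c : 'rV[R]_n) (w : {set 'I_n}) :
  hval (fun g => if g is Some i then c 0 i else 0) w = dotp c (chi R w).
Proof.
rewrite /hval /dotp big_mkcond; apply: eq_bigr => i _; rewrite mxE subr0.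
by case: (i \in w); rewrite ?mulr1 ?mulr0.
Qed.

Theorem corollary3p7 (R : realType) (n : nat) (M : matroid 'I_n) :
  exists S : set (set 'rV[R]_n),
    unimodular_triangulation (independence_polytope R M) S /\
    regular (independence_polytope R M) S.
Proof.
pose V : {set {set 'I_n}} := finset (independent M).
have -> : independence_polytope R M = hull (chi R) V.
  congr conv; apply/seteqP; split=> x [I MI ->]; exists I => //; first by rewrite finset.in_set.
  by rewrite finset.in_set in MI.
pose om := @height R n \o chi R.
have cellE c b : tight (chi R) om V c b =
    cell V (height_from R 0) (fun g => if g is Some i then c 0 i else 0) b.
  by apply/setP=> I; rewrite !finset.in_set hval_chi -height_chi.
have uni T : regular_cells (chi R) om V T -> unimodular_simplex T.
  move=> [c [b [val ->]]]; apply: unimodular_simplex_hull; rewrite cellE.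
  apply: unimodular_cell => //; first exact: exchange_independent.
  by move=> I VI; rewrite hval_chi -height_chi; apply: val.
exists (regular_cells (chi R) om V); split.
  split; last exact: uni.
  split; first exact: regular_cells_subdivision.
  by move=> T /uni[k [v [Tv _ _]]]; exists k, v.
exists [set x | exists2 I, I \in V & x = chi R I]%classic, (@height R n); split.
- apply: (@sub_finite_set _ _ (chi R @` [set: {set 'I_n}])%classic) => [x [I _ ->]|].
    by exists I.
  exact/finite_image/finite_finset.
- by move=> x [I VI ->]; apply: hull_in.
- by move=> x; apply: vertex_hull.
- by rewrite induced_subdivisionE.
Qed.
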